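(* Let $K$ be an algebraically closed field of characteristic zero. Let $W$ be an associative algebra or an $H$-comodule algebra of finite dimension over $K$, where $H$ is a finite-dimensional Hopf algebra over a subfield $k\subseteq K$, and let $K_0\subseteq K$ be the field of invariants of $W$ (in case $W$ is an $H$-comodule algebra, necessarily $k\subseteq K_0$). Then all the identities of $W$ (polynomial identities if $W$ is an algebra, $H$-identities if $W$ is an $H$-comodule algebra) are already defined over $K_0$.
   Context: Identities. A polynomial identity of an associative algebra $W$ is a noncommutative polynomial $f(X_1,\dots,X_n)$ with coefficients in $K$ such that $f(v_1,\dots,v_n)=0$ for all $v_1,\dots,v_n\in W$. For a finite-dimensional Hopf algebra $H$ over $k$, an $H$-comodule algebra over $K$ is an algebra $W$ over $K$ with a right coaction $\rho:W\to W\otimes_k H$ that is an algebra map. For each $i$ let $X_i^H$ be a copy of the vector space $H$ (scalars extended to $K$), with $X_i^h$ the element corresponding to $h$. The tensor algebra $\mathcal T=T(\oplus_i X^H_i)$ is an $H$-comodule algebra via $\rho(X_i^h)=X_i^{h_1}\otimes h_2$ (Sweedler notation). An element $P\in\mathcal T$ is an $H$-identity of $W$ if $\phi(P)=0$ for every homomorphism $\phi:\mathcal T\to W$ of $H$-comodule algebras. ''Defined over $K_0$'' means that the $K$-space of identities is spanned over $K$ by identities with coefficients in $K_0$ (for $H$-identities: lying in the tensor algebra $T(\oplus_i X_i^H)$ formed over $K_0$). Structures. $\mathrm{Vec}_K$ is the category of finite-dimensional $K$-vector spaces; $W^{p,q}=W^{\otimes p}\otimes (W^* )^{\otimes q}$.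 A finite-dimensional structure over $K$ is a finite-dimensional $K$-space $W$ with a family of tensors $x_i\in W^{p_i,q_i}$. An algebra is the structure whose only tensor is its multiplication (in $W^{1,2}$); an $H$-comodule algebra is the structure given by the multiplication and the operators $T_f=(\mathrm{Id}\otimes f)\rho\in W^{1,1}$ for all $f\in H^*$. Kernel completion. Let $\mathcal C$ be a small additive symmetric monoidal rigid category with a faithful additive symmetric monoidal functor $F:\mathcal C\to\mathcal A$ to an abelian symmetric monoidal rigid category. A sequence in $\mathcal C$ is good if $F$ maps it to an exact sequence; $\mathcal C$ is good if every $f:A\to B$ fits in a good sequence $X\to A\to B$ (this is automatic if $\mathcal A=\mathrm{Vec}_K$). For $\mathcal C$ good, let $X^{f,g}\subseteq \mathrm{Hom}_{\mathcal A}(\ker F(f),\ker F(g))$ ($f,g$ morphisms of $\mathcal C$) be the smallest collection of abelian subgroups such that: (1) if $X\xrightarrow{f_1}Y\xrightarrow{f_0}A\xrightarrow{f}B$ is good, $g:C\to D$, $h:Y\to C$, $gh=0$, $hf_1=0$, then the induced map $\ker F(f)\cong \mathrm{coker} F(f_1)\to\ker F(g)$ is in $X^{f,g}$; (2) it is closed under composition; (3) if $a\in X^{f,g}$ is invertible in $\mathcal A$ then $a^{-1}\in X^{g,f}$. The category $\mathrm{Ker}(\mathcal C)_F$ has one object $K(f)$ for each morphism $f$ of $\mathcal C$, $\mathrm{Hom}(K(f),K(g))=X^{f,g}$, and composition as in $\mathcal A$. It is additive rigid symmetric monoidal, with $K(f)\otimes K(g)=K(f\otimes 1\oplus 1\otimes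 g)$ and tensor product of morphisms and symmetry as in $\mathcal A$; it has faithful additive symmetric monoidal functors $\widetilde F:K(f)\mapsto\ker F(f)$ to $\mathcal A$ and $I:A\mapsto K(A\to0)$ from $\mathcal C$, with $\widetilde FI\cong F$. Fundamental category. Let $S^{p,q}\subseteq W^{p,q}$ be the smallest collection of $\mathbb Q$-subspaces such that: $x_i\in S^{p_i,q_i}$; $\mathrm{Id}_W\in S^{1,1}$; $x\in S^{p,q},y\in S^{r,s}$ implies $x\otimes y\in S^{p+r,q+s}$ (after rearranging factors); evaluating the first copy of $W^*$ on the first copy of $W$ sends $S^{p,q}$ to $S^{p-1,q-1}$; $S^{p,q}$ is stable under $S_p\times S_q$ permuting tensor factors; if $0\ne x\in S^{0,0}\subseteq K$ then $x^{-1}\in S^{0,0}$. Let $\mathcal C_0$ have objects $(p,q)\in\mathbb N^2$, $\mathrm{Hom}((p,q),(a,b))=S^{a+q,b+p}\subseteq W^{a+q,b+p}=\mathrm{Hom}_K(W^{p,q},W^{a,b})$ with composition of linear maps, $(p,q)\otimes(a,b)=(p+a,q+b)$, $(p,q)^*=(q,p)$, and $F_0((p,q))=W^{p,q}$. Let $\mathcal C_1$ be its additive envelope (formal finite direct sums), with $F_1$ induced by $F_0$, and $\mathcal C_{n+1}=\mathrm{Ker}(\mathcal C_n)_{F_n}$, $F_{n+1}=\widetilde{F_n}$ for $n\ge1$. Put $\mathcal C_W=\varinjlim \mathcal C_n$, with induced functor $F:\mathcal C_W\to\mathrm{Vec}_K$. Then $\mathcal C_W$ is an abelian rigid symmetric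 monoidal category and $F$ is exact, faithful, additive and symmetric monoidal. The field of invariants of $W$ is $K_0=\mathrm{End}_{\mathcal C_W}(\mathbf 1)$, a subfield of $K$ via $F$. *)

(* Defs.v *)
From mathcomp Require Import all_boot all_order all_algebra perm falgebra finmap.
From mathcomp.multinomials Require Import monalg.

Set Implicit Arguments.
Unset Strict Implicit.
Unset Printing Implicit Defensive.

Import GRing.Theory.
Local Open Scope ring_scope.

Section Structures.
Variables (K : fieldType) (W : vectType K).

Definition bas (i : 'I_(\dim {:W})) : W := (vbasis {:W})`_i.
Definition crd (i : 'I_(\dim {:W})) (w : W) : K := coord (vbasis {:W}) i w.

Definition idx (p q : nat) :=
  (p.-tuple 'I_(\dim {:W}) * q.-tuple 'I_(\dim {:W}))%type.
(* [W^{p,q}], by components in the basis [bas] and its dual basis: [t (I, J)]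
   is the coefficient of [bas I_0 (x) .. (x) bas^* J_0 (x) ..]. *)
Definition tens (p q : nat) : vectType K := {ffun idx p q -> K^o}.

Definition mul_tens (mul : W -> W -> W) : tens 1 2 :=
  [ffun IJ : idx 1 2 =>
     crd (tnth IJ.1 ord0)
         (mul (bas (tnth IJ.2 ord0)) (bas (tnth IJ.2 ord_max)))].

Definition op_tens (T : W -> W) : tens 1 1 :=
  [ffun IJ : idx 1 1 => crd (tnth IJ.1 ord0) (T (bas (tnth IJ.2 ord0)))].

Definition tens_prod p q r s (x : tens p q) (y : tens r s)
  : tens (p + r) (q + s) :=
  [ffun IJ : idx (p + r) (q + s) =>
       x ([tuple tnth IJ.1 (lshift r i) | i < p],
          [tuple tnth IJ.2 (lshift s i) | i < q])
     * y ([tuple tnth IJ.1 (rshift p i) | i < r],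
          [tuple tnth IJ.2 (rshift q i) | i < s])].

Definition tens_contr p q (x : tens p.+1 q.+1) : tens p q :=
  [ffun IJ : idx p q =>
     \sum_(c < \dim {:W}) x ([tuple of c :: IJ.1], [tuple of c :: IJ.2])].

Definition tens_perm p q (s : 'S_p) (r : 'S_q) (x : tens p q) : tens p q :=
  [ffun IJ : idx p q =>
     x ([tuple tnth IJ.1 (s i) | i < p],
        [tuple tnth IJ.2 (r i) | i < q])].

(* The linear map [W^{p,q} -> W^{a,b}] given by an element of [W^{a+q,b+p}],
   the last [q] copies of [W] being paired with the [W^*] factors of the source
   and the last [p] copies of [W^*] with its [W] factors. *)
Definition tens_act p q a b (t : tens (a + q) (b + p)) (v : tens p q)
  : tens a b :=
  [ffun IJ : idx a b =>
     \sum_(PQ : idx p q) t ([tuple of IJ.1 ++ PQ.2], [tuple of IJ.2 ++ PQ.1]) * v PQ].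

Record structure := Structure {
  sidx : Type;
  sp : sidx -> nat;
  sq : sidx -> nat;
  stens : forall i, tens (sp i) (sq i)
}.

(* [inv_one] supplies the identity of the object [(0,0)]; it follows from the
   other rules ([dim W] and its inverse lie in [S^{0,0}]) unless [W = 0]. *)
Inductive inv_tens (X : structure) : forall p q, tens p q -> Prop :=
| inv_base i : inv_tens X (@stens X i)
| inv_id : inv_tens X (op_tens id)
| inv_one : inv_tens X ([ffun=> 1] : tens 0 0)
| inv_zero p q : inv_tens X (0 : tens p q)
| inv_add p q (x y : tens p q) :
    inv_tens X x -> inv_tens X y -> inv_tens X (x + y)
| inv_scale p q (c : rat) (x : tens p q) :
    inv_tens X x -> inv_tens X ((ratr c : K) *: x)
| inv_prod p q r s (x : tens p q) (y : tens r s) :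
    inv_tens X x -> inv_tens X y -> inv_tens X (tens_prod x y)
| inv_contr p q (x : tens p.+1 q.+1) :
    inv_tens X x -> inv_tens X (tens_contr x)
| inv_perm p q (s : 'S_p) (r : 'S_q) (x : tens p q) :
    inv_tens X x -> inv_tens X (tens_perm s r x)
| inv_inv (x : tens 0 0) :
    inv_tens X x -> x != 0 -> inv_tens X ([ffun i => (x i : K)^-1] : tens 0 0).

End Structures.

(* A category given with a faithful functor to [Vec_K], Hom-sets being
   identified with their images.  The tensor structures are not recorded: of
   them, only the unit object enters the field of invariants. *)
Record fcat (K : fieldType) := Fcat {
  ob : Type;
  fib : ob -> vectType K;
  mor : forall A B : ob, 'Hom(fib A, fib B) -> Prop
}.
Arguments ob {K} C : rename.
Arguments fib {K C} A : rename.
Arguments mor {K C A B} f : rename.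

Section AdditiveEnvelope.
Variables (K : fieldType) (C : fcat K).

Fixpoint sum_fib (s : seq (ob C)) : vectType K :=
  if s is A :: s' then (fib A * sum_fib s')%type : vectType K else 'rV[K]_0.

Fixpoint col_mor (A : ob C) (t : seq (ob C)) :
    'Hom(fib A, sum_fib t) -> Prop :=
  match t return 'Hom(fib A, sum_fib t) -> Prop with
  | [::] => fun=> True
  | B :: t' => fun f => exists (g : 'Hom(fib A, fib B)) (h : 'Hom(fib A, sum_fib t')),
      [/\ mor g, col_mor h & forall v, f v = (g v, h v)]
  end.

(* [f] is a matrix of morphisms of [C] *)
Fixpoint sum_mor (s t : seq (ob C)) : 'Hom(sum_fib s, sum_fib t) -> Prop :=
  match s return 'Hom(sum_fib s, sum_fib t) -> Prop with
  | [::] => fun=> True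
  | A :: s' => fun f =>
      exists (g : 'Hom(fib A, sum_fib t)) (h : 'Hom(sum_fib s', sum_fib t)),
      [/\ col_mor g, sum_mor h & forall u v, f (u, v) = g u + h v]
  end.

Definition additive_envelope : fcat K := Fcat sum_mor.

End AdditiveEnvelope.

Section Kernels.
Variables (K : fieldType) (C : fcat K).

Record ker_ob := KerOb {
  ksrc : ob C;
  ktgt : ob C;
  karr : 'Hom(fib ksrc, fib ktgt);
  karrP : mor karr
}.

Definition ker_fib (f : ker_ob) : vectType K := subvs_of (lker (karr f)).

(* In [ker_induced], [limg f1 = lker f0] and [limg f0 = lker (karr f)] say that
   [X -> Y -> A -> B] is good, and the last hypothesis says that [u] is the map
   [ker f = coker f1 -> ker g] induced by [h]. *)
Inductive ker_mor : forall f g : ker_ob, 'Hom(ker_fib f, ker_fib g) -> Prop :=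
| ker_induced (f g : ker_ob) (X Y : ob C) (f1 : 'Hom(fib X, fib Y))
    (f0 : 'Hom(fib Y, fib (ksrc f))) (h : 'Hom(fib Y, fib (ksrc g)))
    (u : 'Hom(ker_fib f, ker_fib g)) :
    mor f1 -> mor f0 -> mor h ->
    limg f1 = lker f0 -> limg f0 = lker (karr f) ->
    (karr g \o h)%VF = 0 -> (h \o f1)%VF = 0 ->
    (forall (y : fib Y) (x : ker_fib f), vsval x = f0 y -> vsval (u x) = h y) ->
    ker_mor u
| ker_zero f g : ker_mor (0 : 'Hom(ker_fib f, ker_fib g))
| ker_add f g (u v : 'Hom(ker_fib f, ker_fib g)) :
    ker_mor u -> ker_mor v -> ker_mor (u + v)
| ker_opp f g (u : 'Hom(ker_fib f, ker_fib g)) : ker_mor u -> ker_mor (- u)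
| ker_comp f g h (u : 'Hom(ker_fib f, ker_fib g)) (v : 'Hom(ker_fib g, ker_fib h)) :
    ker_mor u -> ker_mor v -> ker_mor (v \o u)%VF
| ker_inv f g (u : 'Hom(ker_fib f, ker_fib g)) (v : 'Hom(ker_fib g, ker_fib f)) :
    ker_mor u -> (v \o u)%VF = \1%VF -> (u \o v)%VF = \1%VF -> ker_mor v.

Definition ker_fcat : fcat K := Fcat ker_mor.

End Kernels.

Record pcat (K : fieldType) := Pcat {
  pcat_fcat :> fcat K;
  zob : ob pcat_fcat;
  uob : ob pcat_fcat;
  morz : forall A : ob pcat_fcat, mor (0 : 'Hom(fib A, fib zob))
}.

(* The functor [I], [A |-> K(A -> 0)] *)
Definition ker_incl (K : fieldType) (C : pcat K) (A : ob C) : ob (ker_fcat C) :=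
  KerOb (morz A).

Definition ker_pcat (K : fieldType) (C : pcat K) : pcat K :=
  @Pcat K (ker_fcat C) (ker_incl (zob C)) (ker_incl (uob C))
    (fun f => ker_zero f (ker_incl (zob C))).

Section Fundamental.
Variables (K : fieldType) (W : vectType K) (X : structure W).

Definition C0 : fcat K :=
  @Fcat K (nat * nat)%type (fun pq => tens W pq.1 pq.2)
    (fun pq ab f => exists2 t : tens W (ab.1 + pq.2) (ab.2 + pq.1),
       inv_tens X t & forall v, f v = tens_act t v).

Lemma C1_morz (s : seq (nat * nat)) :
  @sum_mor K C0 s [::] 0.
Proof.
elim: s => [|A s IHs] //=; exists 0, 0; split=> // u v.
by rewrite !lfunE addr0.
Qed.

Definition C1 : pcat K :=
  @Pcat K (additive_envelope C0) [::] [:: (0, 0)%N] C1_morz.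

(* [stage n] is the category [C_{n+1}] *)
Fixpoint stage (n : nat) : pcat K :=
  if n is n'.+1 then ker_pcat (stage n') else C1.

(* Morphisms in the direct limit of the [stage n]: those of the single stages,
   transported along the isomorphisms [F A = ker (F A -> 0) = F (I A)]. *)
Inductive lim_mor : forall n m (A : ob (stage n)) (B : ob (stage m)),
    'Hom(fib A, fib B) -> Prop :=
| lim_stage n (A B : ob (stage n)) (f : 'Hom(fib A, fib B)) :
    mor f -> lim_mor f
| lim_src n m (A : ob (stage n)) (B : ob (stage m)) (f : 'Hom(fib A, fib B))
    (g : 'Hom(@fib K (stage n.+1) (ker_incl A), fib B)) :
    @lim_mor n.+1 m (ker_incl A) B g ->
    (forall x : ker_fib (ker_incl A), f (vsval x) = g x) -> lim_mor f
| lim_tgt n m (A : ob (stage n)) (B : ob (stage m)) (f : 'Hom(fib A, fib B))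
    (g : 'Hom(fib A, @fib K (stage m.+1) (ker_incl B))) :
    @lim_mor n m.+1 A (ker_incl B) g ->
    (forall v, f v = vsval (g v : ker_fib (ker_incl B))) -> lim_mor f.

Definition CW : fcat K :=
  @Fcat K {n & ob (stage n)} (fun A => fib (tagged A))
    (fun A B f => lim_mor f).

Definition CW_unit : ob CW := existT (fun n => ob (stage n)) 0%N (uob C1).

(* [End_{C_W}(1)] as a subset of [K = End (F 1)] *)
Definition field_of_invariants (c : K) : Prop :=
  @mor K CW CW_unit CW_unit (c *: \1%VF).

End Fundamental.

Notation free_alg K A := {malg K[{fmonom A}]}.

(* The [K]-subspace [Id] is spanned by its elements with coefficients in [K0]. *)
Definition defined_over (K : fieldType) (A : choiceType) (K0 : K -> Prop)
    (Id : free_alg K A -> Prop) : Prop :=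
  forall P : free_alg K A, Id P <->
    exists (n : nat) (c : 'I_n -> K) (Q : 'I_n -> free_alg K A),
      (forall i, Id (Q i) /\ forall w, K0 (Q i)@_w) /\
      P = \sum_i c i *: Q i.

Section Algebra.
Variables (K : fieldType) (W : vectType K) (mul : W -> W -> W).

Definition algebra_structure : structure W :=
  @Structure K W unit (fun=> 1%N) (fun=> 2%N) (fun=> mul_tens mul).

Fixpoint word_val (e : W) (v : nat -> W) (w : seq nat) : W :=
  match w with
  | [::] => e
  | [:: i] => v i
  | i :: w' => mul (v i) (word_val e v w')
  end.

Definition eval (e : W) (v : nat -> W) (f : free_alg K nat) : W :=
  \sum_(w <- msupp f) f@_w *: word_val e v w.

(* [W] need not have a unit; a polynomial with nonzero constant term can be
   evaluated, and hence be an identity, only if it has one. *)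
Definition polynomial_identity (f : free_alg K nat) : Prop :=
  exists e : W,
    (f@_mone = 0 \/ (left_id e mul /\ right_id e mul)) /\
    forall v : nat -> W, eval e v f = 0.

End Algebra.

(* For a [k]-algebra [H] of finite dimension and a space [V] over an extension
   [K] of [k], [V (x)_k H] is represented by the families [t] of elements of
   [V], standing for [\sum_i t i (x) bas i]. *)
Section TensorH.
Variables (k : fieldType) (H : falgType k) (K : fieldType).
Variable iota : {rmorphism k -> K}.

Definition tensH (V : Type) := {ffun 'I_(\dim {:H}) -> V}.

Definition pureH (V : lmodType K) (v : V) (h : H) : tensH V :=
  [ffun i => iota (crd i h) *: v].

Definition mulH (A : lalgType K) (s t : tensH A) : tensH A :=
  \sum_i \sum_j pureH (s i * t j) (bas i * bas j).

(* [Id (x) f : V (x) H -> V], for [f] in [H^*] *)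
Definition applyH (V : lmodType K) (f : H -> k) (t : tensH V) : V :=
  \sum_i iota (f (bas i)) *: t i.

(* [Id (x) D : V (x) H -> (V (x) H) (x) H] *)
Definition idDelta (D : H -> {ffun 'I_(\dim {:H}) -> H}) (V : lmodType K)
    (t : tensH V) : tensH (tensH V) :=
  [ffun j => \sum_l pureH (t l) (D (bas l) j)].

(* [r (x) Id : V (x) H -> V' (x) H] *)
Definition mapH (V V' : Type) (r : V -> V') (t : {ffun 'I_(\dim {:H}) -> V}) :
  {ffun 'I_(\dim {:H}) -> V'} := [ffun j => r (t j)].

End TensorH.
Arguments tensH {k} H V.
Arguments applyH {k H K} iota {V} f t.
Arguments idDelta {k H K} iota D {V} t.
Arguments pureH {k H K} iota {V} v h.
Arguments mulH {k H K} iota {A} s t.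
Arguments mapH {k H V V'} r t.

Record hopf (k : fieldType) (H : falgType k) := Hopf {
  Delta : 'Hom(H, tensH H H);
  eps : 'Hom(H, k^o);
  antipode : 'End(H);
  Delta_coassoc : forall h, mapH Delta (Delta h) = idDelta idfun Delta (Delta h);
  eps_counitl : forall h, \sum_i eps (Delta h i) *: bas i = h;
  eps_counitr : forall h, applyH idfun eps (Delta h) = h;
  Delta1 : Delta 1 = pureH idfun 1 1;
  DeltaM : forall g h, Delta (g * h) = mulH idfun (Delta g) (Delta h);
  eps1 : eps 1 = 1;
  epsM : forall g h, eps (g * h) = eps g * eps h;
  antipodel : forall h, \sum_i antipode (Delta h i) * bas i = (eps h : k) *: 1;
  antipoder : forall h, \sum_i Delta h i * antipode (bas i) = (eps h : k) *: 1
}.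

Section ComoduleAlgebra.
Variables (k : fieldType) (H : falgType k) (hH : hopf H).
Variables (K : fieldType) (iota : {rmorphism k -> K}).

Record comodule_algebra (W : falgType K) := ComoduleAlgebra {
  rho : 'Hom(W, tensH H W);
  rho_coassoc : forall w, mapH rho (rho w) = idDelta iota (Delta hH) (rho w);
  rho_counit : forall w, applyH iota (eps hH) (rho w) = w;
  rho1 : rho 1 = pureH iota 1 1;
  rhoM : forall v w, rho (v * w) = mulH iota (rho v) (rho w)
}.

Definition comodule_algebra_structure (W : falgType K)
    (c : comodule_algebra W) : structure W :=
  @Structure K W (option 'Hom(H, k^o)) (fun=> 1%N)
    (fun o => if o is Some _ then 1%N else 2%N)
    (fun o => match o return tens W 1 (if o is Some _ then 1%N else 2%N) with
              | None => mul_tens *%R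
              | Some f => op_tens (fun w => applyH iota f (rho c w))
              end).

(* The tensor algebra of [\bigoplus_i X_i^H]: the letter [(i, j)] stands for
   [X_i^{bas j}]. *)
Definition tensor_alg := free_alg K (nat * 'I_(\dim {:H}))%type.

Definition gen (i : nat) (h : H) : tensor_alg :=
  \sum_j iota (crd j h) *: (<< fmu (i, j) >> : tensor_alg).

Definition rho_letter (a : nat * 'I_(\dim {:H})) : tensH H tensor_alg :=
  mapH (gen a.1) (Delta hH (bas a.2)).

(* The algebra map extending [X_i^h |-> X_i^{h_1} (x) h_2] *)
Definition rhoT (P : tensor_alg) : tensH H tensor_alg :=
  \sum_(w <- msupp P)
    P@_w *: foldr (fun a t => mulH iota (rho_letter a) t) (pureH iota 1 1)
              (w : seq (nat * 'I_(\dim {:H}))).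

Definition H_identity (W : falgType K) (c : comodule_algebra W)
    (P : tensor_alg) : Prop :=
  forall phi : {lrmorphism tensor_alg -> W},
    (forall Q, rho c (phi Q) = mapH phi (rhoT Q)) -> phi P = 0.

End ComoduleAlgebra.

(* Main.v *)
(* An identity of multidegree (1, ..., 1) is a linear relation between the tensors
   obtained by permuting the arguments of an iterated product, and these tensors
   are invariant; in characteristic zero every identity is a combination of
   identities obtained from multilinear ones by substituting variables, through
   full polarization. So it suffices that the relations between invariant tensors
   [x_i] are spanned by relations with coefficients in the field of invariants.

   If [y = c x] with [x <> 0] and [x], [y] invariant, then [x] and [y] are
   morphisms from the unit to the kernel [K x] of [v |-> v (x) x - x (x) v]; the
   first is invertible, and the second followed by its inverse is [c]. If
   [y = \sum_i c_i x_i] with independent [x_i], taking the antisymmetrized product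
   with some [x_j] removes the [j]-th term and keeps the others independent, which
   reduces to the case of one term.

   For H-identities, a left integral [t] of [H] generates [H] freely over [H^*]:
   [f |-> t_1 f(t_2)] is bijective. Hence a comodule map [H -> W] sends [bas j] to
   [T_(f_j) w], where [w], the image of [t], is arbitrary and [f_j] corresponds to
   [bas j]. So H-identities are identities with letters [T_(f_j) X_i], whose
   operators are invariant. *)

From HB Require Import structures.
Require Import Defs.
From mathcomp Require Import all_boot all_order all_algebra all_field.
From mathcomp Require Import perm finmap zify.
From mathcomp.multinomials Require Import monalg.

Import GRing.Theory.
Local Open Scope ring_scope.

Set Implicit Arguments.
Unset Strict Implicit.
Unset Printing Implicit Defensive.

(** * Invariant scalars *)

(** [lfunE] needs a bundled linear map. Here the bare predicate is packed on the fly, so that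
    [linfun] can be used on functions such as [fun u => F (u, 0)]. *)
Lemma linfun_app (K : fieldType) (aT rT : vectType K) (f : aT -> rT) :
  linear f -> linfun f =1 f.
Proof.
move=> f_lin; pose F : {linear aT -> rT} :=
  HB.pack f (GRing.isLinear.Build K aT rT *:%R f f_lin).
exact: (lfunE F).
Qed.

Section Invariants.
Variables (K : fieldType) (W : vectType K) (X : structure W).

Local Notation I := 'I_(\dim {:W}).
Local Notation C1 := (C1 X).

(* The elements of the field of invariants that appear already in [stage 1]. They
   suffice below, and their sums need not be formed across different stages. *)
Definition scalar_mor (c : K) : Prop :=
  @ker_mor K C1 (ker_incl (uob C1)) (ker_incl (uob C1)) (c *: \1%VF).

Lemma scalar_mor_invariant c : scalar_mor c -> field_of_invariants X c.
Proof.
move=> cP; set U := uob C1.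
(* The unit of stage 0 is compared with its image in stage 1 one side at a time; [g] is the scalar
   [c] with only the source moved. *)
pose g : 'Hom(ker_fib (ker_incl U), fib U) := c *: linfun vsval.
apply: (@lim_src _ _ X 0 0 U U _ g); last first.
  by move=> x; rewrite !lfunE /= !lfunE.
apply: (@lim_tgt _ _ X 1 0 (ker_incl U) U g (c *: \1%VF)); last first.
  by move=> v; rewrite !lfunE /= !lfunE.
exact: (@lim_stage _ _ X 1).
Qed.

Lemma scalar_morD c d : scalar_mor c -> scalar_mor d -> scalar_mor (c + d).
Proof. by move=> cP dP; rewrite /scalar_mor scalerDl; apply: ker_add. Qed.

Lemma scalar_morN c : scalar_mor c -> scalar_mor (- c).
Proof. by move=> cP; rewrite /scalar_mor scaleNr; apply: ker_opp. Qed.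

Lemma scalar_mor0 : scalar_mor 0.
Proof. by rewrite /scalar_mor scale0r; apply: ker_zero. Qed.

(** The fibre of a one-term sum is a pair whose second entry lies in the zero space ['rV_0], so the
    single matrix entry determines the map. *)
Lemma sum_mor1 (U V : nat * nat)
    (F : 'Hom(@sum_fib K (C0 X) [:: U], @sum_fib K (C0 X) [:: V]))
    (t : tens W (V.1 + U.2) (V.2 + U.1)) :
  inv_tens X t -> (forall v, (F v).1 = tens_act t v.1) -> sum_mor F.
Proof.
move=> tP Ft.
pose g : 'Hom(tens W U.1 U.2, @sum_fib K (C0 X) [:: V]) :=
  linfun (fun u => F (u, 0)).
have gE u : g u = F (u, 0).
  rewrite linfun_app // => a v w; rewrite -linearP; congr (F _).
  by apply: injective_projections => //=; rewrite scaler0 addr0.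
pose g' : 'Hom(tens W U.1 U.2, tens W V.1 V.2) := linfun (fun u => (F (u, 0)).1).
have g'E u : g' u = (F (u, 0)).1.
  by rewrite linfun_app // => a v w; rewrite -!gE linearP.
exists g, 0; split=> //.
  exists g', 0; split=> //.
    by exists t => // v; rewrite g'E Ft.
  move=> v; rewrite g'E gE lfunE /=; case: (F _) => a b /=; congr (_, _).
  by rewrite [b]thinmx0.
by move=> u v; rewrite gE lfunE /= addr0; congr (F (_, _)); rewrite [v]thinmx0.
Qed.

Definition idx0 : idx W 0 0 := ([tuple], [tuple]).

Lemma idx0_eq (i : idx W 0 0) : i = idx0.
Proof. by case: i => a b; rewrite [a]tuple0 [b]tuple0. Qed.

Lemma sum_idx0 (V : nmodType) (F : idx W 0 0 -> V) : \sum_i F i = F idx0.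
Proof. by rewrite (bigD1 idx0) //= big1 ?addr0 // => i /eqP[]; apply: idx0_eq. Qed.

Section Reindex.
Variables (p p' q q' : nat) (s : 'I_p -> 'I_p') (r : 'I_q -> 'I_q').
Hypotheses (epp : p = p') (eqq : q = q') (s_inj : injective s) (r_inj : injective r).

(** An injection between index sets of equal size is a permutation. The equality of sizes stays
    propositional because sums such as [q + p + q] and [q + q + p] are not convertible. *)
Lemma inv_reindex (x : tens W p q) : inv_tens X x ->
  inv_tens X ([ffun IJ : idx W p' q' =>
     x ([tuple tnth IJ.1 (s i) | i < p],
       [tuple tnth IJ.2 (r i) | i < q])] : tens W p' q').
Proof.
move=> xP; move: s r s_inj r_inj; case: _ / epp; case: _ / eqq => s1 r1 s1_inj r1_inj.
have := inv_perm (perm s1_inj) (perm r1_inj) xP.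
congr (inv_tens X _); apply/ffunP => IJ; rewrite !ffunE.
by congr (x (_, _)); apply: eq_from_tnth => i; rewrite !tnth_mktuple permE.
Qed.

End Reindex.

Fixpoint id_tens n : tens W n n :=
  if n is n'.+1 then tens_prod (op_tens id) (id_tens n') else [ffun=> 1].

Lemma inv_id_tens n : inv_tens X (id_tens n).
Proof.
elim: n => [|n IHn] /=; first exact: inv_one.
exact: (inv_prod (inv_id X) IHn).
Qed.

Lemma crd_bas (i j : I) : crd i (bas j) = (i == j)%:R.
Proof. by rewrite /crd /bas coord_free ?(basis_free (vbasisP _)) // eq_sym. Qed.

Lemma id_tensE n IJ : id_tens n IJ = (IJ.1 == IJ.2)%:R.
Proof.
elim: n IJ => [|n IHn] [A B] /=.
  by rewrite ffunE [A]tuple0 [B]tuple0 eqxx.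
rewrite ffunE IHn /= /op_tens ffunE /= !tnth_mktuple crd_bas -natrM mulnb.
congr (_%:R); congr nat_of_bool; apply/andP/eqP => [[/eqP e0 /eqP e1]|->//].
apply: eq_from_tnth => i; case: (unliftP ord0 i) => [j|] ->.
  move/(congr1 (fun t => tnth t j)): e1; rewrite !tnth_mktuple.
  by rewrite (_ : rshift 1 j = lift ord0 j) //; apply: val_inj.
by move: e0; rewrite (_ : lshift n (ord0 : 'I_1) = ord0) //; apply: val_inj.
Qed.

End Invariants.

(** * Maps out of a sum of three index blocks *)

Section Blocks.
Variables (a b c n : nat) (f : 'I_a -> 'I_n) (g : 'I_b -> 'I_n) (h : 'I_c -> 'I_n).

Definition blocks (i : 'I_(a + b + c)) : 'I_n :=
  match split i with
  | inl j => match split j with inl k => f k | inr k => g k end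
  | inr k => h k
  end.

Lemma blocks1 i : blocks (lshift c (lshift b i)) = f i.
Proof. by rewrite /blocks !(unsplitK (inl _)). Qed.

Lemma blocks2 i : blocks (lshift c (rshift a i)) = g i.
Proof. by rewrite /blocks (unsplitK (inl _)) (unsplitK (inr _)). Qed.

Lemma blocks3 i : blocks (rshift (a + b) i) = h i.
Proof. by rewrite /blocks (unsplitK (inr _)). Qed.

Lemma blocks_inj : injective f -> injective g -> injective h ->
  (forall i j, f i != g j) -> (forall i j, f i != h j) -> (forall i j, g i != h j) ->
  injective blocks.
Proof.
move=> fI gI hI fg fh gh i j.
rewrite -[i]splitK -[j]splitK.
case: (split i) => [k|k]; case: (split j) => [l|l] /=;
  try (rewrite -[k]splitK; case: (split k) => {}k /=);
  try (rewrite -[l]splitK; case: (split l) => {}l /=);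
  rewrite ?blocks1 ?blocks2 ?blocks3.
- by move/fI->.
- by move/eqP; rewrite (negbTE (fg _ _)).
- by move/esym/eqP; rewrite (negbTE (fg _ _)).
- by move/gI->.
- by move/eqP; rewrite (negbTE (fh _ _)).
- by move/eqP; rewrite (negbTE (gh _ _)).
- by move/esym/eqP; rewrite (negbTE (fh _ _)).
- by move/esym/eqP; rewrite (negbTE (gh _ _)).
- by move/hI->.
Qed.

End Blocks.

(** * Tensor multiplication by an invariant tensor as a morphism *)

Section TensorMultiplication.
Variables (K : fieldType) (W : vectType K) (X : structure W).

Local Notation I := 'I_(\dim {:W}).

Variables (p q : nat) (x : tens W p q).
Hypothesis xP : inv_tens X x.

(** The tensor is [x (x) Id^p (x) Id^q]: the first identity carries the upper indices of [v], the
    second the lower ones. Its lower blocks have sizes [q, p, q]; [r] puts the contracted block [p]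
    last, as [tens_act] requires. *)
Lemma inv_lmul : exists2 t : tens W ((p + p) + q) ((q + q) + p),
  inv_tens X t & forall v : tens W p q, tens_act t v = tens_prod x v.
Proof.
pose r := @blocks q p q (q + q + p) (fun i => lshift p (lshift q i))
  (fun i => rshift (q + q) i) (fun i => lshift p (rshift q i)).
have r_inj : injective r.
  apply: blocks_inj => [i j|i j|i j|i j|i j|i j];
  try (by move/(congr1 val) => /= e; apply: val_inj => /=; lia);
  by apply/eqP => /(congr1 val) /=; have := ltn_ord i; have := ltn_ord j; lia.
pose t : tens W (p + p + q) (q + q + p) := [ffun IJ : idx W _ _ =>
  tens_prod (tens_prod x (id_tens W p)) (id_tens W q)
     ([tuple tnth IJ.1 i | i < p + p + q],
      [tuple tnth IJ.2 (r i) | i < q + p + q])].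
exists t.
  apply: (@inv_reindex _ _ X _ _ _ _ id r erefl (addnAC q p q) _ r_inj).
    exact: inj_id.
  exact: (inv_prod (inv_prod xP (inv_id_tens X p)) (inv_id_tens X q)).
move=> v; apply/ffunP => -[A B]; rewrite !ffunE /=.
set A1 := [tuple tnth A _ | i < p]; set A2 := [tuple tnth A _ | i < p].
set B1 := [tuple tnth B _ | i < q]; set B2 := [tuple tnth B _ | i < q].
have tE (P : p.-tuple I) (Q : q.-tuple I) :
    t ([tuple of A ++ Q], [tuple of B ++ P]) =
    x (A1, B1) * (A2 == P)%:R * (Q == B2)%:R.
  rewrite !ffunE !id_tensE /=.
  congr (_ * _ * _); first [congr (_ (_, _)) | congr ((_ == _)%:R)];
  apply: eq_from_tnth => i;
  by rewrite !tnth_mktuple /r ?blocks1 ?blocks2 ?blocks3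
     ?(tnth_lshift, tnth_rshift) ?tnth_mktuple.
(* The two identity tensors leave only the term indexed by the part of [(A, B)] that belongs to
   [v]. *)
rewrite (bigD1 (A2, B2)) //= [X in _ + X]big1 ?addr0 => [|[P Q] neq].
  by rewrite tE !eqxx !mulr1.
rewrite tE; case: (A2 =P P) => [PE|_]; last by rewrite mulr0 !mul0r.
case: (Q =P B2) => [QE|_]; last by rewrite mulr0 mul0r.
by rewrite PE QE eqxx in neq.
Qed.

(** The tensor is now [Id^p (x) x (x) Id^q]; its lower blocks, of sizes [p, q, q], are the
    contracted one, that of [x] and that of [v]. *)
Lemma inv_rmul : exists2 t : tens W ((p + p) + q) ((q + q) + p),
  inv_tens X t & forall v : tens W p q, tens_act t v = tens_prod v x.
Proof.
pose r := @blocks p q q (q + q + p) (fun i => rshift (q + q) i)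
  (fun i => lshift p (rshift q i)) (fun i => lshift p (lshift q i)).
have r_inj : injective r.
  apply: blocks_inj => [i j|i j|i j|i j|i j|i j];
  try (by move/(congr1 val) => /= e; apply: val_inj => /=; lia);
  by apply/eqP => /(congr1 val) /=; have := ltn_ord i; have := ltn_ord j; lia.
pose t : tens W (p + p + q) (q + q + p) := [ffun IJ : idx W _ _ =>
  tens_prod (tens_prod (id_tens W p) x) (id_tens W q)
     ([tuple tnth IJ.1 i | i < p + p + q],
      [tuple tnth IJ.2 (r i) | i < p + q + q])].
exists t.
  apply: (@inv_reindex _ _ X _ _ _ _ id r erefl _ _ r_inj).
  - by rewrite addnC addnA addnAC addnC addnA.
  - exact: inj_id.
  - exact: (inv_prod (inv_prod (inv_id_tens X p) xP) (inv_id_tens X q)).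
move=> v; apply/ffunP => -[A B]; rewrite !ffunE /=.
set A1 := [tuple tnth A _ | i < p]; set A2 := [tuple tnth A _ | i < p].
set B1 := [tuple tnth B _ | i < q]; set B2 := [tuple tnth B _ | i < q].
have tE (P : p.-tuple I) (Q : q.-tuple I) :
    t ([tuple of A ++ Q], [tuple of B ++ P]) =
    x (A2, B2) * (A1 == P)%:R * (Q == B1)%:R.
  rewrite [x _ * _]mulrC !ffunE !id_tensE /=.
  congr (_ * _ * _); first [congr (_ (_, _)) | congr ((_ == _)%:R)];
  apply: eq_from_tnth => i;
  by rewrite !tnth_mktuple /r ?blocks1 ?blocks2 ?blocks3
     ?(tnth_lshift, tnth_rshift) ?tnth_mktuple.
rewrite (bigD1 (A1, B1)) //= [X in _ + X]big1 ?addr0 => [|[P Q] neq].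
  by rewrite tE !eqxx !mulr1 mulrC.
rewrite tE; case: (A1 =P P) => [PE|_]; last by rewrite mulr0 !mul0r.
case: (Q =P B1) => [QE|_]; last by rewrite mulr0 mul0r.
by rewrite PE QE eqxx in neq.
Qed.

End TensorMultiplication.

(** * The antisymmetrized product and ratios of invariant tensors *)

Section Wedge.
Variables (K : fieldType) (W : vectType K) (X : structure W).

Local Notation I := 'I_(\dim {:W}).
Local Notation C1 := (C1 X).

Lemma tens_prod_linearl p q r s (y : tens W r s) :
  linear (fun x : tens W p q => tens_prod x y).
Proof.
move=> a x x'; apply/ffunP => IJ; rewrite !ffunE /=.
by rewrite mulrDl -mulrA.
Qed.

Lemma tens_prod_linearr p q r s (x : tens W p q) :
  linear (fun y : tens W r s => tens_prod x y).
Proof.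
move=> a y y'; apply/ffunP => IJ; rewrite !ffunE /=.
by rewrite mulrDr mulrCA.
Qed.

Definition wedge p q (x y : tens W p q) : tens W (p + p) (q + q) :=
  tens_prod x y - tens_prod y x.

Lemma wedge_linear p q (y : tens W p q) : linear (fun x => wedge x y).
Proof.
move=> a x x'; rewrite /wedge tens_prod_linearl tens_prod_linearr.
by rewrite scalerBr opprD addrACA.
Qed.

Lemma wedgexx p q (x : tens W p q) : wedge x x = 0.
Proof. exact: subrr. Qed.

Lemma wedge0 p q (x : tens W p q) : wedge 0 x = 0.
Proof. by apply/ffunP => AB; rewrite !ffunE mul0r mulr0 subrr. Qed.

(** Reading [y (x) x = x (x) y] at a pair of indices [AB], [IJ] with [x IJ] nonzero gives the factor
    [c = y IJ / x IJ]. *)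
Lemma wedge_eq0 p q (x y : tens W p q) :
  x != 0 -> wedge y x = 0 -> exists c, y = c *: x.
Proof.
move=> x_neq0 /eqP; rewrite subr_eq0 => /eqP yx.
have [IJ xIJ] : exists IJ, x IJ != 0.
  apply/existsP; rewrite -negb_forall; apply: contra x_neq0 => /forallP x0.
  by apply/eqP/ffunP => IJ; rewrite ffunE; apply/eqP.
exists (y IJ / x IJ); apply/ffunP => AB; rewrite ffunE.
apply: (mulIf xIJ); rewrite mulrAC divfK //.
move/ffunP: yx => /(_ ([tuple of AB.1 ++ IJ.1], [tuple of AB.2 ++ IJ.2])).
rewrite !ffunE /=.
have catl n m (s : n.-tuple I) (t : m.-tuple I) :
    [tuple tnth [tuple of s ++ t] (lshift m i) | i < n] = s.
  by apply: eq_from_tnth => i; rewrite tnth_mktuple tnth_lshift.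
have catr n m (s : n.-tuple I) (t : m.-tuple I) :
    [tuple tnth [tuple of s ++ t] (rshift n i) | i < m] = t.
  by apply: eq_from_tnth => i; rewrite tnth_mktuple tnth_rshift.
rewrite !catl !catr => yxE.
by case: AB IJ yxE {xIJ} => A B [A' B'] /= ->; rewrite mulrC.
Qed.

Lemma inv_sub p q (x y : tens W p q) :
  inv_tens X x -> inv_tens X y -> inv_tens X (x - y).
Proof.
move=> xP yP; apply: inv_add => //.
have ratrN1 : ratr (-1) = -1 :> K by rewrite /ratr rmorphN1 invr1 mulr1.
by have := inv_scale (-1) yP; rewrite ratrN1 scaleN1r.
Qed.

Lemma inv_wedge p q (x y : tens W p q) :
  inv_tens X x -> inv_tens X y -> inv_tens X (wedge x y).
Proof. by move=> xP yP; apply: inv_sub; apply: inv_prod. Qed.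

Lemma inv_wedgel p q (x : tens W p q) : inv_tens X x ->
  exists2 t : tens W ((p + p) + q) ((q + q) + p),
  inv_tens X t & forall v : tens W p q, tens_act t v = wedge v x.
Proof.
move=> xP; have [l lP lE] := inv_lmul xP; have [r rP rE] := inv_rmul xP.
exists (r - l); first exact: inv_sub.
move=> v; rewrite /wedge -lE -rE; apply/ffunP => AB; rewrite !ffunE /= -sumrB.
by apply: eq_bigr => PQ _; rewrite !ffunE mulrBl.
Qed.

Let U : ob C1 := uob C1.
Let e : fib U := ([ffun=> 1], 0).

Definition tens_hom p q (x : tens W p q) :
    'Hom(fib U, @sum_fib K (C0 X) [:: (p, q)]) :=
  linfun (fun v : fib U => (v.1 (idx0 W) *: x, 0)).

Lemma tens_homE p q (x : tens W p q) v : tens_hom x v = (v.1 (idx0 W) *: x, 0).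
Proof.
rewrite linfun_app // => a [u u'] [w w']; apply: injective_projections => /=.
  by rewrite !ffunE scalerDl scalerA.
by rewrite scaler0 addr0.
Qed.

Lemma tens_hom_mor p q (x : tens W p q) : inv_tens X x -> mor (tens_hom x).
Proof.
(* The factor [[ffun=> 1]] of degree [(0, 0)] brings the degree [(p, q)] into the form
   [(p + 0, q + 0)] of a morphism from the unit. *)
move=> xP; apply: (@sum_mor1 _ _ X (0, 0)%N (p, q) _ (tens_prod x [ffun=> 1])).
  exact: (inv_prod xP (inv_one X)).
move=> v; rewrite tens_homE /=; apply/ffunP => AB; rewrite !ffunE sum_idx0.
rewrite !ffunE /= mulr1 mulrC; congr (_ * x _).
by case: AB => A B /=; congr (_, _); apply: eq_from_tnth => i;
  rewrite tnth_mktuple tnth_lshift.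
Qed.

Lemma unitE (v : fib U) : v = v.1 (idx0 W) *: e.
Proof.
apply: injective_projections => /=; last by rewrite !thinmx0.
by apply/ffunP => i; rewrite !ffunE (idx0_eq i) [_ *: _]mulr1.
Qed.

Lemma tens_hom1 v : tens_hom [ffun=> 1] v = v.
Proof.
rewrite tens_homE [in RHS](unitE v); apply: injective_projections => //=.
by rewrite scaler0.
Qed.

Section Ratio.
Variables (p q : nat) (x : tens W p q).
Hypotheses (xP : inv_tens X x) (x_neq0 : x != 0).

Definition wedge_hom : 'Hom(@sum_fib K (C0 X) [:: (p, q)],
    @sum_fib K (C0 X) [:: ((p + p)%N, (q + q)%N)]) :=
  linfun (fun v : @sum_fib K (C0 X) [:: (p, q)] => (wedge v.1 x, 0)).

Lemma wedge_homE v : wedge_hom v = (wedge v.1 x, 0).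
Proof.
rewrite linfun_app // => a u w; apply: injective_projections => /=.
  by rewrite wedge_linear.
by rewrite scaler0 addr0.
Qed.

Lemma wedge_hom_mor : @mor K C1 [:: (p, q)] [:: ((p + p)%N, (q + q)%N)] wedge_hom.
Proof.
have [t tP tE] := inv_wedgel xP.
apply: (@sum_mor1 _ _ X (p, q) ((p + p)%N, (q + q)%N) _ t) => // v.
by rewrite wedge_homE tE.
Qed.

Let G : ob (ker_pcat C1) := KerOb wedge_hom_mor.

(* The line [K x], as the subobject of [W^{p,q}] cut out by [wedge _ x]. *)
Let point (c : K) : 'Hom(fib (ker_incl U), fib G) :=
  linfun (fun v => vsproj (lker wedge_hom) (tens_hom (c *: x) (vsval v))).

Let tens_hom_ker c v : wedge_hom (tens_hom (c *: x) v) = 0.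
Proof.
rewrite tens_homE wedge_homE; apply: injective_projections => //=.
rewrite scalerA -[_ *: x]addr0 wedge_linear wedgexx scaler0 add0r.
exact: wedge0.
Qed.

Let pointE c v : vsval (point c v) = tens_hom (c *: x) (vsval v).
Proof.
rewrite linfun_app => [|a u w]; last by rewrite !linearP.
by rewrite vsprojK // memv_ker tens_hom_ker.
Qed.

Let point_mor c : inv_tens X (c *: x) -> ker_mor (point c).
Proof.
move=> cxP.
(* The good sequence is [0 -> U -> U -> 0] with the identity in the middle, so that a morphism out
   of [ker_incl U] is induced by one out of [U]. *)
apply: (@ker_induced K C1 (ker_incl U) G [::] U 0 (tens_hom [ffun=> 1]) (tens_hom (c *: x))).
- by [].
- exact/tens_hom_mor/inv_one.
- exact: tens_hom_mor.
- by rewrite lim0g; apply/esym/eqP/lker0P => v w; rewrite !tens_hom1.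
- apply/vspaceP => v; rewrite memv_ker lfunE eqxx; apply/memv_imgP.
  by exists v; rewrite ?memvf // tens_hom1.
- by apply/lfunP => v; rewrite !lfunE /= tens_hom_ker.
- by apply/lfunP => v; rewrite !lfunE /= lfunE /= linear0.
- by move=> y v vE; rewrite pointE vE tens_hom1.
Qed.

Lemma ratio_scalar_mor c : inv_tens X (c *: x) -> scalar_mor X c.
Proof.
move=> cxP; have x_mor : ker_mor (point 1) by apply: point_mor; rewrite scale1r.
have pointZ v : point c v = c *: point 1 v.
  apply: val_inj; apply: (etrans (pointE c v)).
  rewrite -[RHS]/(c *: vsval (point 1 v)) pointE.
  rewrite !tens_homE; apply: injective_projections => /=; last by rewrite scaler0.
  by rewrite scale1r !scalerA mulrC.
have ker0 : lker (point 1) == 0%VS.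
  apply/lker0P => v w /(congr1 vsval); rewrite !pointE !tens_homE scale1r => -[].
  move/eqP; rewrite -subr_eq0 -scalerBl scaler_eq0 (negbTE x_neq0) orbF subr_eq0.
  by move/eqP => vw; apply: val_inj; rewrite /= [vsval v]unitE vw -unitE.
(* The kernel of [wedge_hom] consists of multiples of [x] by [wedge_eq0], hence [point 1] is also
   onto. *)
have surj (w : fib G) : point 1 ((point 1)^-1%VF w) = w.
  apply: limg_lfunVK; have := valP w; rewrite memv_ker wedge_homE => /eqP [] w0.
  have [b wb] := wedge_eq0 x_neq0 w0.
  have beK : b *: e \in lker (karr (ker_incl U)) by rewrite memv_ker lfunE.
  apply/memv_imgP; exists (Subvs beK); first exact: memvf.
  apply: val_inj; rewrite [RHS]pointE tens_homE /= !ffunE scale1r.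
  apply: injective_projections => /=; last by rewrite !thinmx0.
  by rewrite wb [b *: 1]mulr1.
pose inv := (point 1)^-1%VF.
rewrite /scalar_mor (_ : c *: \1%VF = (inv \o point c)%VF); last first.
  apply/lfunP => v; rewrite !lfunE /= lfunE /= pointZ linearZ /=.
  by rewrite lker0_lfunK.
apply: ker_comp (point_mor cxP) _; apply: ker_inv x_mor _ _.
  exact: lker0_compVf.
by apply/lfunP => w; rewrite !lfunE /= surj.
Qed.

End Ratio.
End Wedge.

(** * Linear relations between invariant tensors *)

Section Relations.
Import VectorInternalTheory.
Variables (K : fieldType) (W : vectType K) (X : structure W).

Lemma scalar_mor1 : scalar_mor X 1.
Proof.
have one_neq0 : ([ffun=> 1] : tens W 0 0) != 0.
  by apply/eqP => /ffunP/(_ (idx0 W))/eqP; rewrite !ffunE oner_eq0.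
apply: (ratio_scalar_mor (inv_one X) one_neq0); rewrite scale1r; exact: inv_one.
Qed.

Lemma scalar_mor_nat (n : nat) : scalar_mor X n%:R.
Proof.
elim: n => [|n IHn]; first exact: scalar_mor0.
by rewrite -natr1; apply: scalar_morD => //; apply: scalar_mor1.
Qed.

Lemma scalar_mor_sum (T : Type) (r : seq T) (P : pred T) (F : T -> K) :
  (forall i, P i -> scalar_mor X (F i)) -> scalar_mor X (\sum_(i <- r | P i) F i).
Proof. by move=> FP; apply: big_ind => //; [apply: scalar_mor0|apply: scalar_morD]. Qed.

Lemma wedge_suml p q n (a : 'I_n -> K) (x : 'I_n -> tens W p q) y :
  wedge (\sum_i a i *: x i) y = \sum_i a i *: wedge (x i) y.
Proof.
elim/big_rec2: _ => [|i u v _ <-]; first exact: wedge0.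
by rewrite wedge_linear.
Qed.

(** Induction on the number of terms, with [p] and [q] varying because [wedge] doubles them. To
    reach [c i], the sum is wedged with [x j] for some [j] other than [i]. *)
Lemma coef_scalar_mor n p q (x : 'I_n.+1 -> tens W p q) (c : 'I_n.+1 -> K) :
    (forall i, inv_tens X (x i)) -> inv_tens X (\sum_i c i *: x i) ->
    (forall a : 'I_n.+1 -> K, \sum_i a i *: x i = 0 -> forall i, a i = 0) ->
  forall i, scalar_mor X (c i).
Proof.
elim: n p q x c => [|n IHn] p q x c xP yP x_free i.
  have xi_neq0 : x i != 0.
    apply/eqP => xi0; have s0 : \sum_k 1 *: x k = 0.
      by rewrite big_ord1 scale1r -xi0 (ord1 i).
    by have /eqP := x_free (fun=> 1) s0 i; rewrite oner_eq0.
  by apply: (ratio_scalar_mor (xP i) xi_neq0); move: yP; rewrite big_ord1 (ord1 i).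
pose j : 'I_n.+2 := if i == ord0 then ord_max else ord0.
have ij : j != i by rewrite /j; case: (eqVneq i ord0) => [->|i0] //; rewrite eq_sym.
have [i' ->] : exists i', i = lift j i' by case: (unlift_some ij) => i' ? _; exists i'.
have sumE (a : 'I_n.+2 -> K) :
    wedge (\sum_k a k *: x k) (x j) = \sum_k a (lift j k) *: wedge (x (lift j k)) (x j).
  rewrite wedge_suml (bigD1_ord j) //= wedgexx scaler0 add0r.
  by apply: eq_bigr.
apply: (IHn _ _ (fun k => wedge (x (lift j k)) (x j)) (fun k => c (lift j k))).
- by move=> k; apply: inv_wedge.
- by rewrite -sumE; apply: inv_wedge.
move=> a a0 k.
have xj_neq0 : x j != 0.
  apply/eqP => xj0; have s0 : \sum_k (k == j)%:R *: x k = 0.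
    rewrite (bigD1 j) //= xj0 scaler0 add0r big1 // => l /negPf->.
    exact: scale0r.
  by have /eqP := x_free _ s0 j; rewrite eqxx oner_eq0.
(* [a1] extends [a] by zero at [j]. Its combination wedges to zero with [x j], hence is [b *: x j];
   subtracting [b] at [j] gives [a2], a relation between the independent [x]. *)
pose a1 l := oapp a 0 (unlift j l).
have a1E l : a1 (lift j l) = a l by rewrite /a1 liftK.
have [|b ab] := @wedge_eq0 _ _ _ _ (x j) (\sum_k a1 k *: x k) xj_neq0.
  by rewrite sumE -[RHS]a0; apply: eq_bigr => l _; rewrite a1E.
pose a2 l := a1 l - b *+ (l == j).
rewrite -a1E; suff: a2 (lift j k) = 0.
  by rewrite /a2 eq_sym (negbTE (neq_lift _ _)) subr0.
apply: x_free; under eq_bigr do rewrite scalerBl; rewrite sumrB ab.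
rewrite (bigD1 j) //= eqxx big1 ?addr0 ?subrr // => l /negPf->; exact: scale0r.
Qed.

(* Relations between invariant tensors are spanned by the rows of [1 - C B'],
   where [B'] selects a maximal independent subfamily and the row [j] of [C]
   expresses the [j]-th tensor in terms of this subfamily. *)
Lemma relations_scalar_mor N p q (x : 'I_N -> tens W p q) (a : 'I_N -> K) :
    (forall i, inv_tens X (x i)) -> \sum_i a i *: x i = 0 ->
  exists R : 'I_N -> 'I_N -> K,
    [/\ forall j i, scalar_mor X (R j i), forall j, \sum_i R j i *: x i = 0
      & forall i, a i = \sum_j a j * R j i].
Proof.
move=> xP ax0.
pose A := \matrix_i v2r (x i).
pose f : 'I_(\rank A) -> 'I_N := maxrankfun A; pose B := rowsub f A.
pose C := A *m pinvmx B.
have rowA i : row i A = v2r (x i) by rewrite rowK.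
have AC : A = C *m B by rewrite mulmxKpV // eq_maxrowsub.
have B_free : row_free B by apply: maxrowsub_free.
have BE i : row i B = v2r (x (f i)) by rewrite row_rowsub rowA.
have xC j : x j = \sum_i C j i *: x (f i).
  apply: (can_inj v2rK); rewrite -rowA {1}AC row_mul mulmx_sum_row linear_sum.
  by apply: eq_bigr => i _; rewrite BE mxE linearZ.
have x_free (b : 'I_(\rank A) -> K) : \sum_i b i *: x (f i) = 0 -> forall i, b i = 0.
  move=> b0 i; suff : \row_i b i = 0 :> 'rV_(\rank A) by move/rowP/(_ i); rewrite !mxE.
  apply: (row_free_inj B_free); rewrite mul0mx mulmx_sum_row.
  under eq_bigr do rewrite BE mxE -linearZ.
  by rewrite -linear_sum b0 linear0.
have gen r (g : 'I_r -> 'I_N) c j :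
    (forall b, \sum_i b i *: x (g i) = 0 -> forall i, b i = 0) ->
    x j = \sum_i c i *: x (g i) -> forall i, scalar_mor X (c i).
  case: r g c => [|r] g c g_free xg; first by case.
  by apply: (coef_scalar_mor (x := fun i => x (g i))) => //; rewrite -xg.
have CP j i : scalar_mor X (C j i) by apply: (gen _ f (C j) j) => //; apply: xC.
(* Written in the independent subfamily, the given relation says [a C = 0], whence
   [a = a (1 - C B')]. *)
have aC i : \sum_j a j * C j i = 0.
  apply: (x_free (fun i => \sum_j a j * C j i)).
  transitivity (\sum_j \sum_k (a j * C j k) *: x (f k)).
    by rewrite exchange_big; apply: eq_bigr => k _; apply: scaler_suml.
  rewrite -[RHS]ax0; apply: eq_bigr => j _; rewrite [in RHS]xC scaler_sumr.
  by apply: eq_bigr => k _; rewrite scalerA.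
exists (fun j i => (j == i)%:R - \sum_k C j k * (f k == i)%:R); split.
- move=> j i; apply: scalar_morD; first exact: scalar_mor_nat.
  apply: scalar_morN; apply: scalar_mor_sum => k _.
  by case: eqP; rewrite ?mulr1 ?mulr0 //; move=> _; apply: scalar_mor0.
- have delta k : \sum_i (k == i)%:R *: x i = x k.
    rewrite (bigD1 k) //= eqxx scale1r big1 ?addr0 // => i.
    by rewrite eq_sym => /negPf->; rewrite scale0r.
  move=> j; under eq_bigr do rewrite scalerBl scaler_suml.
  rewrite sumrB delta exchange_big /= {1}(xC j) -sumrB big1 // => k _.
  under eq_bigr do rewrite -scalerA.
  by rewrite -scaler_sumr delta subrr.
- move=> i; under eq_bigr do rewrite mulrBr mulr_sumr.
  rewrite sumrB exchange_big /= [X in _ - X]big1 => [|k _].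
    rewrite subr0 (bigD1 i) //= eqxx mulr1 big1 ?addr0 // => j /negPf->.
    exact: mulr0.
  under eq_bigr do rewrite mulrA.
  by rewrite -mulr_suml aC mul0r.
Qed.

Lemma relations_scalar_mor_fin (T : finType) p q (x : T -> tens W p q) (a : T -> K) :
    (forall i, inv_tens X (x i)) -> \sum_i a i *: x i = 0 ->
  exists R : T -> T -> K,
    [/\ forall j i, scalar_mor X (R j i), forall j, \sum_i R j i *: x i = 0
      & forall i, a i = \sum_j a j * R j i].
Proof.
have sumE (V : nmodType) (F : T -> V) : \sum_(i < #|T|) F (enum_val i) = \sum_i F i.
  by rewrite -(big_enum_val (A := T) F); apply: eq_bigl.
move=> xP ax0; have [R [RK R0 aR]] := @relations_scalar_mor _ _ _
  (fun i => x (enum_val i)) (fun i => a (enum_val i)) (fun i => xP _)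
  (etrans (sumE _ (fun i => a i *: x i)) ax0).
exists (fun j i => R (enum_rank j) (enum_rank i)); split=> //.
  move=> j; rewrite -sumE -[RHS](R0 (enum_rank j)).
  by apply: eq_bigr => i _; rewrite enum_valK.
move=> i; rewrite -{1}(enum_rankK i) aR -sumE.
by apply: eq_bigr => j _; rewrite enum_valK.
Qed.

End Relations.

(** * Products of linear operators as invariant tensors *)

Lemma sum_ffun_recl (V : nmodType) n (T : finType) (F : {ffun 'I_n.+1 -> T} -> V) :
  \sum_s F s =
  \sum_l \sum_(s : {ffun 'I_n -> T}) F [ffun k => oapp s l (unlift ord0 k)].
Proof.
rewrite pair_big; pose h (p : T * {ffun 'I_n -> T}) : {ffun 'I_n.+1 -> T} :=
  [ffun k => oapp p.2 p.1 (unlift ord0 k)].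
rewrite (reindex h) //.
exists (fun s : {ffun 'I_n.+1 -> T} => (s ord0, [ffun k => s (lift ord0 k)])).
  move=> [l s] _; rewrite /h ffunE unlift_none /=; congr (_, _).
  by apply/ffunP => k; rewrite !ffunE liftK.
move=> s _; apply/ffunP => k; rewrite !ffunE.
by case: unliftP => [j|] -> //=; rewrite ffunE.
Qed.

(** * Consequences of the bare predicate [linear] *)

Section Linear.
Variables (K : fieldType) (U V : lmodType K) (f : U -> V).
Hypothesis f_lin : linear f.

Lemma linearity0 : f 0 = 0.
Proof. by have := f_lin (-1) 0 0; rewrite scaler0 add0r scaleN1r addNr. Qed.

Lemma linearityZ a u : f (a *: u) = a *: f u.
Proof. by rewrite -[a *: u]addr0 f_lin linearity0 addr0. Qed.

Lemma linearity_sum (T : Type) (r : seq T) (P : pred T) v :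
  f (\sum_(i <- r | P i) v i) = \sum_(i <- r | P i) f (v i).
Proof.
elim/big_rec2: _ => [|i x y _ <-]; first exact: linearity0.
by rewrite -[v i]scale1r f_lin !scale1r.
Qed.

End Linear.

(** * Iterated products of vectors and their tensors *)

Section Products.
Variables (K : fieldType) (W : vectType K) (mul : W -> W -> W).
Hypotheses (mul_linl : forall y, linear (mul^~ y)) (mul_linr : forall x, linear (mul x)).

Lemma sum_crd (w : W) : w = \sum_i crd i w *: bas i.
Proof. exact: coord_vbasis (memvf w). Qed.

Lemma crd_sumZ (T : Type) (r : seq T) (P : pred T) (c : T -> K) (v : T -> W) i :
  crd i (\sum_(j <- r | P j) c j *: v j) = \sum_(j <- r | P j) c j * crd i (v j).
Proof. by rewrite /crd linear_sum; apply: eq_bigr => j _; rewrite linearZ. Qed.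

Lemma crd_inj (u v : W) : (forall i, crd i u = crd i v) -> u = v.
Proof. by move=> uv; rewrite (sum_crd u) (sum_crd v); apply: eq_bigr => i _; rewrite uv. Qed.

(** Nested to the right like [word_val], and over nonempty families only, since [W] may have no
    unit. *)
Fixpoint wprod n : ('I_n.+1 -> W) -> W :=
  if n is n'.+1 then fun f => mul (f ord0) (wprod (fun k => f (lift ord0 k)))
  else fun f => f ord0.

Lemma eq_wprod n (f g : 'I_n.+1 -> W) : f =1 g -> wprod f = wprod g.
Proof.
elim: n f g => [|n IHn] f g fg /=; first exact: fg.
by rewrite fg (IHn _ (fun k => g (lift ord0 k))).
Qed.

Lemma wprodZ n (c : 'I_n.+1 -> K) (f : 'I_n.+1 -> W) :
  wprod (fun k => c k *: f k) = (\prod_k c k) *: wprod f.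
Proof.
elim: n c f => [|n IHn] c f /=; first by rewrite big_ord1.
rewrite IHn [in RHS]big_ord_recl /= -scalerA (linearityZ (mul_linl _)).
by rewrite /= (linearityZ (mul_linr _)).
Qed.

Lemma wprod_sum n (T : finType) (F : 'I_n.+1 -> T -> W) :
  wprod (fun k => \sum_l F k l) =
  \sum_(s : {ffun 'I_n.+1 -> T}) wprod (fun k => F k (s k)).
Proof.
elim: n F => [|n IHn] F /=.
  rewrite sum_ffun_recl; apply: eq_bigr => l _.
  rewrite (bigD1 [ffun k : 'I_0 => l]) //= big1 ?addr0 => [|s /eqP[]].
    by rewrite ffunE unlift_none.
  by apply/ffunP => -[].
rewrite IHn [RHS]sum_ffun_recl (linearity_sum (mul_linl _)); apply: eq_bigr => l _.
rewrite (linearity_sum (mul_linr _)); apply: eq_bigr => s _.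
rewrite ffunE unlift_none /=; congr (mul _ _).
by apply: eq_wprod => k; rewrite ffunE liftK.
Qed.

Lemma wprod_bas n (theta : 'I_n.+1 -> W -> W) (z : 'I_n.+1 -> W) :
  (forall k, linear (theta k)) ->
  wprod (fun k => theta k (z k)) =
  \sum_(J : {ffun 'I_n.+1 -> 'I_(\dim {:W})})
     (\prod_k crd (J k) (z k)) *: wprod (fun k => theta k (bas (J k))).
Proof.
move=> theta_lin; under [RHS]eq_bigr do rewrite -wprodZ.
rewrite -(wprod_sum (fun k i => crd i (z k) *: theta k (bas i))); apply: eq_wprod => k.
rewrite {1}[z k]sum_crd (linearity_sum (theta_lin k)).
by apply: eq_bigr => i _; rewrite (linearityZ (theta_lin k)).
Qed.

(** The tensor of the multilinear map that sends [z] to the product of the [theta k (z k)]. *)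
Definition prod_tens n (theta : 'I_n.+1 -> W -> W) : tens W 1 n.+1 :=
  [ffun IJ => crd (tnth IJ.1 ord0) (wprod (fun k => theta k (bas (tnth IJ.2 k))))].

Variable X : structure W.

(** With [Z] the tensor of the remaining factors, contract the product of [theta ord0], [Z] and the
    multiplication twice. The map [r] brings the two inputs of the multiplication to the front,
    where they meet the outputs of [theta ord0] and of [Z]. *)
Lemma inv_prod_tens n (theta : 'I_n.+1 -> W -> W) :
    inv_tens X (mul_tens mul) ->
    (forall k, linear (theta k)) -> (forall k, inv_tens X (op_tens (theta k))) ->
  inv_tens X (prod_tens theta).
Proof.
move=> mulP; elim: n theta => [|n IHn] theta theta_lin thetaP.
  suff <- : op_tens (theta ord0) = prod_tens theta by [].
  by apply/ffunP => AB; rewrite !ffunE.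
have := IHn (fun k => theta (lift ord0 k)) (fun k => theta_lin _) (fun k => thetaP _).
set Z := prod_tens _ => ZP.
pose r : 'I_(1 + n.+1 + 2) -> 'I_(2 + (1 + n.+1)) :=
  blocks (fun i : 'I_1 => rshift 2 (lshift n.+1 i)) (fun i => rshift 2 (rshift 1 i))
         (fun i => lshift (1 + n.+1) i).
have r_inj : injective r.
  apply: blocks_inj => [i j|i j|i j|i j|i j|i j];
  try (by move/(congr1 val) => /= e; apply: val_inj => /=; lia);
  by apply/eqP => /(congr1 val) /=; have := ltn_ord i; have := ltn_ord j; lia.
have := inv_contr (inv_contr (inv_reindex (p' := 3) (s := id) erefl
  (addnC (1 + n.+1) 2) (@inj_id _) r_inj
  (inv_prod (inv_prod (thetaP ord0) ZP) mulP))).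
congr inv_tens; apply/ffunP => -[A B]; rewrite !ffunE /=.
transitivity (\sum_c \sum_c' crd c' (theta ord0 (bas (tnth B ord0))) *
    crd c (wprod (fun k => theta (lift ord0 k) (bas (tnth B (lift ord0 k))))) *
    crd (tnth A ord0) (mul (bas c') (bas c))).
  apply: eq_bigr => c _; rewrite ffunE /=; apply: eq_bigr => c' _; rewrite !ffunE /=.
  rewrite !tnth_mktuple /r blocks1 !blocks3.
  congr (_ * _ * _).
  - congr (crd _ (theta _ (bas _))).
    by rewrite !(tnth_nth c).
  - apply: congr2; first by rewrite !(tnth_nth c).
    apply: eq_wprod => k; rewrite !tnth_mktuple blocks2.
    by rewrite !(tnth_nth c).
  - by rewrite !(tnth_nth c).
set u := theta ord0 _; set v := wprod _.
rewrite {2}[u]sum_crd (linearity_sum (mul_linl _)) /=.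
under [in RHS]eq_bigr => c' _.
  rewrite (linearityZ (mul_linl _)) {1}[v]sum_crd (linearity_sum (mul_linr _)) /=.
  rewrite scaler_sumr.
  under eq_bigr do rewrite (linearityZ (mul_linr _)) scalerA.
  over.
rewrite exchange_big /crd linear_sum; apply: eq_bigr => c' _.
rewrite linear_sum; apply: eq_bigr => c _.
by rewrite linearZ.
Qed.

End Products.

(** * Noncommutative polynomials *)

Section Infinite.
Variable K : fieldType.
Hypothesis charK : [pchar K] =i pred0.

Lemma natr_inj_pchar0 : injective (fun n => n%:R : K).
Proof.
have char0 := (pcharf0P _).1 charK.
move=> m n; wlog le_mn : m n / (m <= n)%N.
  by move=> IH; case: (leqP m n) => [|/ltnW] le e; [|symmetry]; apply: IH.
move/esym/eqP; rewrite -subr_eq0 -natrB // char0 subn_eq0 => le_nm.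
by apply/eqP; rewrite eqn_leq le_mn.
Qed.

(** In characteristic zero the naturals below [size p] are distinct, too many roots for a nonzero
    [p]. *)
Lemma poly_eq0_horner (p : {poly K}) : (forall t, p.[t] = 0) -> p = 0.
Proof.
move=> p0; apply/eqP/negPn/negP => p_neq0.
have := @max_poly_roots _ p [seq i%:R | i <- iota 0 (size p)] p_neq0.
rewrite size_map size_iota ltnn map_inj_uniq ?iota_uniq; last exact: natr_inj_pchar0.
have -> : all (root p) [seq i%:R | i <- iota 0 (size p)].
  by apply/allP => t _; apply/eqP/p0.
by move/(_ isT isT).
Qed.

End Infinite.

(** Uniqueness of digits in base [b]: reduction modulo [b] gives the lowest one, division by [b] the
    rest. *)
Lemma digits_inj b n (c d : 'I_n -> nat) :
    (forall i, c i < b)%N -> (forall i, d i < b)%N ->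
    (\sum_i c i * b ^ i = \sum_i d i * b ^ i)%N -> c =1 d.
Proof.
elim: n c d => [|n IHn] c d cb db; first by move=> _ [].
rewrite !big_ord_recl /= !muln1.
have shift (f : 'I_n.+1 -> nat) :
    (\sum_(i < n) f (lift ord0 i) * b ^ bump 0 i =
     (\sum_(i < n) f (lift ord0 i) * b ^ i) * b)%N.
  by rewrite big_distrl; apply: eq_bigr => i _; rewrite /= expnS [RHS]mulnC mulnCA.
rewrite !shift => e.
have e0 : c ord0 = d ord0.
  by move/(congr1 (modn^~ b)): e; rewrite ![(_ + _ * b)%N]addnC !modnMDl !modn_small.
have b_gt0 : (0 < b)%N by apply: leq_ltn_trans (cb ord0).
have /IHn IH : (\sum_(i < n) c (lift ord0 i) * b ^ i =
    \sum_(i < n) d (lift ord0 i) * b ^ i)%N.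
  by move/eqP: e; rewrite e0 eqn_add2l eqn_pmul2r // => /eqP.
move=> i; case: (unliftP ord0 i) => [j|] -> //.
by apply: IH => k.
Qed.

(* The exponents used to extract multilinear parts: a monomial in which the
   [l]-th variable has degree [c l < b] is recognized by [\sum_l c l * b ^ l]. *)
Lemma exponents_inj b m n (s : 'I_m -> 'I_n) : (m < b)%N -> (1 < b)%N ->
  (\sum_k b ^ s k = \sum_(l < n) b ^ l)%N -> m = n /\ injective s.
Proof.
move=> mb b1 e; pose c (l : 'I_n) := #|[set k | s k == l]|.
have sumE (F : 'I_n -> nat) : (\sum_k F (s k) = \sum_l c l * F l)%N.
  rewrite (partition_big s predT) //=; apply: eq_bigr => l _.
  rewrite (eq_bigr (fun=> F l)) => [|k /eqP-> //].
  by rewrite sum_nat_const; congr (_ * _)%N; apply: eq_card => k; rewrite !inE.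
(* The multiplicities are at most [m < b], hence are the base-[b] digits of a number all of whose
   digits are 1. *)
have c1 l : c l = 1%N.
  apply: (@digits_inj b n c (fun=> 1%N)) => // [i|].
    by apply: leq_ltn_trans mb; rewrite -[m in leqRHS]card_ord max_card.
  by rewrite -sumE e; apply: eq_bigr => i _; rewrite mul1n.
split.
  have := sumE (fun=> 1%N); rewrite !sum1_card card_ord.
  under eq_bigr do rewrite c1 muln1.
  by rewrite sum1_card card_ord.
move=> k k' ss; have /cards1P[x xE] : #|[set i | s i == s k]| == 1%N by apply/eqP; apply: c1.
have : k \in [set i | s i == s k] by rewrite inE.
have : k' \in [set i | s i == s k] by rewrite inE ss.
by rewrite xE !inE => /eqP-> /eqP->.
Qed.

Lemma malgU_scale (A : choiceType) (R : comNzRingType) (a : R) (w : A) :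
  << a *g w >> = a *: << w >> :> {malg R[A]}.
Proof. by apply/malgP => u; rewrite mcoeffZ !mcoeffU mulr_natr. Qed.

(** * Linear extension from words to polynomials *)

Section Extension.
Variables (K : fieldType) (A : choiceType) (V : lmodType K) (F : seq A -> V).

(** Both [eval] and [rhoT] have this form. *)
Definition malg_ext (P : free_alg K A) : V := \sum_(w <- msupp P) P@_w *: F w.

Lemma malg_extEw (D : {fset {fmonom A}}) (P : free_alg K A) : (msupp P `<=` D)%fset ->
  malg_ext P = \sum_(w <- D) P@_w *: F w.
Proof.
move=> PD; apply: big_fset_incl => // w _ /mcoeff_outdom ->; exact: scale0r.
Qed.

Lemma malg_ext_linear : linear malg_ext.
Proof.
move=> a P Q; pose D := (msupp P `|` msupp Q)%fset.
have DP : (msupp P `<=` D)%fset by apply: fsubsetUl.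
have DQ : (msupp Q `<=` D)%fset by apply: fsubsetUr.
have DPQ : (msupp (a *: P + Q) `<=` D)%fset.
  by apply: fsubset_trans (msuppD_le _ _) _; apply: fsetSU; apply: msuppZ_le.
rewrite (malg_extEw DP) (malg_extEw DQ) (malg_extEw DPQ) scaler_sumr -big_split /=.
by apply: eq_bigr => w _; rewrite mcoeffD mcoeffZ scalerDl scalerA.
Qed.

Lemma malg_extU w : malg_ext << w >> = F w.
Proof. by rewrite /malg_ext msuppU1 big_seq_fset1 mcoeffU1 eqxx scale1r. Qed.

End Extension.

(* A letter [mk i j] stands for an operator, indexed by [j], applied to the [i]-th
   variable. *)
Section Words.
Variables (K : fieldType) (J : finType) (A : choiceType).
Variables (mk : nat -> J -> A) (var : A -> nat) (typ : A -> J).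
Hypotheses (mkK : forall a, mk (var a) (typ a) = a)
  (var_mk : forall i j, var (mk i j) = i) (typ_mk : forall i j, typ (mk i j) = j).

Definition word n (i : 'I_n -> nat) (j : 'I_n -> J) : {fmonom A} :=
  FMonom [seq mk (i k) (j k) | k <- enum 'I_n].

Lemma size_word n i j : size (@word n i j) = n.
Proof. by rewrite size_map size_enum_ord. Qed.

Lemma eq_word n (i i' : 'I_n -> nat) (j j' : 'I_n -> J) :
  i =1 i' -> j =1 j' -> word i j = word i' j'.
Proof. by move=> ii' jj'; congr FMonom; apply: eq_map => k; rewrite ii' jj'. Qed.

Lemma word_inj n (i i' : 'I_n -> nat) (j j' : 'I_n -> J) :
  word i j = word i' j' -> i =1 i' /\ j =1 j'.
Proof.
case=> /eq_in_map e; split=> k.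
  by rewrite -(var_mk (i k) (j k)) e ?var_mk // mem_enum.
by rewrite -(typ_mk (i k) (j k)) e ?typ_mk // mem_enum.
Qed.

Lemma wordK (w : {fmonom A}) :
  exists (i : 'I_(size w) -> nat) (j : 'I_(size w) -> J),
    w = word i j /\ forall k, exists2 a, a \in (w : seq A) & i k = var a.
Proof.
exists (fun k => var (tnth (in_tuple w) k)), (fun k => typ (tnth (in_tuple w) k)).
split=> [|k]; last by exists (tnth (in_tuple w) k) => //; apply: mem_tnth.
rewrite -[LHS]fmK; congr FMonom; under eq_map do rewrite mkK.
by rewrite map_tnth_enum.
Qed.

(** [N] bounds the lengths of the monomials and [M] their variables. The sum over the support
    becomes a sum over finite function types, on which symmetric groups act. *)
Lemma malg_words (P : free_alg K A) : exists N M : nat,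
  P = \sum_(n < N) \sum_(i : {ffun 'I_n -> 'I_M.+1}) \sum_(j : {ffun 'I_n -> J})
        P@_(word (fun k => i k) j) *: << word (fun k => i k) j >>.
Proof.
pose S := enum_fset (msupp P).
pose N := (\max_(w <- S) size (w : seq A)).+1.
pose M := \max_(w <- S) \max_(a <- (w : seq A)) var a.
exists N, M; apply/malgP => w; rewrite raddf_sum /=.
under eq_bigr do rewrite raddf_sum /=.
under eq_bigr do under eq_bigr do rewrite raddf_sum /=.
under eq_bigr do under eq_bigr do under eq_bigr do rewrite mcoeffZ mcoeffU1.
case: (boolP (w \in S)) => [wS|wNS]; last first.
  rewrite mcoeff_outdom // !big1 // => n _; rewrite big1 // => i _; rewrite big1 // => j _.
  by case: eqP => [->|_]; rewrite ?mulr0 // mcoeff_outdom ?mul0r.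
have [i [j [wE iE]]] := wordK w.
have wN : (size w < N)%N by rewrite ltnS; apply: leq_bigmax_seq.
have iM k : (i k < M.+1)%N.
  rewrite ltnS; have [a aw ->] := iE k.
  apply: (@leq_trans (\max_(a <- (w : seq A)) var a)); first exact: leq_bigmax_seq.
  exact: (@leq_bigmax_seq _ S xpredT (fun w : {fmonom A} => \max_(a <- (w : seq A)) var a)%N).
rewrite (bigD1 (Ordinal wN)) //= [X in _ + X]big1 ?addr0 => [|n neq]; last first.
  rewrite big1 // => i' _; rewrite big1 // => j' _.
  case: eqP => [we|_]; last by rewrite mulr0.
  by move/eqP: neq => []; apply: val_inj; rewrite /= -we size_word.
pose i0 := [ffun k => Ordinal (iM k)].
rewrite (bigD1 i0) //= [X in _ + X]big1 ?addr0 => [|i' neq]; last first.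
  rewrite big1 // => j' _; case: eqP => [/(fun e => etrans e wE)/word_inj[ii _]|_];
    last by rewrite mulr0.
  by move/eqP: neq => []; apply/ffunP => k; apply: val_inj; rewrite ffunE /= ii.
rewrite (bigD1 (finfun j)) //= [X in _ + X]big1 ?addr0 => [|j' neq]; last first.
  case: eqP => [/(fun e => etrans e wE)/word_inj[_ jj]|_];
    last by rewrite mulr0.
  by move/eqP: neq => []; apply/ffunP => k; rewrite ffunE jj.
have -> : word (fun k => i0 k) (finfun j) = w.
  by apply: etrans (esym wE); apply: eq_word => k; rewrite ffunE.
by rewrite eqxx mulr1.
Qed.

End Words.

(** * Multilinear parts of identities *)

Lemma sum_split (V : nmodType) m n (f : 'I_m -> V) (g : 'I_n -> V) :
  \sum_(i < m + n) match split i with inl k => f k | inr k => g k end =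
  \sum_i f i + \sum_i g i.
Proof.
rewrite big_split_ord; congr (_ + _); apply: eq_bigr => i _.
  by rewrite (unsplitK (inl _)).
by rewrite (unsplitK (inr _)).
Qed.

(** * Spans of identities with restricted coefficients *)

Section Spanned.
Variables (K : fieldType) (A : choiceType) (K0 : K -> Prop) (Id : free_alg K A -> Prop).

(** The right-hand side of [defined_over]. *)
Definition spanned (P : free_alg K A) : Prop :=
  exists (n : nat) (c : 'I_n -> K) (Q : 'I_n -> free_alg K A),
    (forall i, Id (Q i) /\ forall w, K0 (Q i)@_w) /\ P = \sum_i c i *: Q i.

Lemma spanned_scale c P : Id P -> (forall w, K0 P@_w) -> spanned (c *: P).
Proof. by move=> IdP PK0; exists 1%N, (fun=> c), (fun=> P); rewrite big_ord1. Qed.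

Lemma spanned0 : spanned 0.
Proof.
by exists 0%N, (fun=> 0), (fun=> 0); split; [case|rewrite big_ord0].
Qed.

Lemma spannedD P Q : spanned P -> spanned Q -> spanned (P + Q).
Proof.
move=> [m [c [F [FP ->]]]] [n [d [G [GP ->]]]].
exists (m + n)%N, (fun i => match split i with inl k => c k | inr k => d k end),
  (fun i => match split i with inl k => F k | inr k => G k end); split.
  by move=> i; case: (split i).
by rewrite -sum_split; apply: eq_bigr => i _; case: (split i).
Qed.

Lemma spanned_sum (T : Type) (r : seq T) (p : pred T) (F : T -> free_alg K A) :
  (forall i, p i -> spanned (F i)) -> spanned (\sum_(i <- r | p i) F i).
Proof. by move=> FP; apply: big_ind => //; [apply: spanned0|apply: spannedD]. Qed.

Lemma spannedZ a P : spanned P -> spanned (a *: P).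
Proof.
move=> [m [c [F [FP ->]]]]; exists m, (fun i => a * c i), F; split=> //.
by rewrite scaler_sumr; apply: eq_bigr => i _; rewrite scalerA.
Qed.

End Spanned.

Lemma spannedW (K : fieldType) (A : choiceType) (K0 K1 : K -> Prop)
    (I J : free_alg K A -> Prop) P :
  (forall c, K0 c -> K1 c) -> (forall Q, I Q -> J Q) -> spanned K0 I P -> spanned K1 J P.
Proof.
move=> K01 IJ [n [c [Q [QP ->]]]]; exists n, c, Q; split=> // i.
by have [QI QK] := QP i; split=> [|w]; [apply: IJ|apply: K01].
Qed.

(** For the degenerate case [W = 0]: monomials are then identities, with coefficients 0 and 1. *)
Lemma spanned_words (K : fieldType) (W : vectType K) (S : structure W) (A : choiceType)
    (I : free_alg K A -> Prop) P :
  (forall Q, I Q) -> spanned (scalar_mor S) I P.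
Proof.
move=> IQ; rewrite [P]monalgE; apply: spanned_sum => w _.
rewrite malgU_scale; apply: spanned_scale => // u; rewrite mcoeffU1.
exact: scalar_mor_nat.
Qed.

Lemma ffun_perm_bij n (T : finType) (s : 'S_n) :
  bijective (fun L : {ffun 'I_n -> T} => [ffun k => L (s k)]).
Proof.
exists (fun L : {ffun 'I_n -> T} => [ffun k => L ((s^-1)%g k)]) => L;
  by apply/ffunP => k; rewrite !ffunE ?permK ?permKV.
Qed.

(** * Identities in letters that apply operators to variables *)

Section Identities.
Variables (K : fieldType) (charK : [pchar K] =i pred0) (W : vectType K).
Variable mul : W -> W -> W.
Hypotheses (mul_linl : forall y, linear (mul^~ y)) (mul_linr : forall x, linear (mul x)).
Variables (J : finType) (tau : J -> W -> W).
Hypothesis tau_lin : forall j, linear (tau j).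
Variables (A : choiceType) (mk : nat -> J -> A) (var : A -> nat) (typ : A -> J).
Hypotheses (mkK : forall a, mk (var a) (typ a) = a)
  (var_mk : forall i j, var (mk i j) = i) (typ_mk : forall i j, typ (mk i j) = j).
Variable ev : (nat -> W) -> seq A -> W.
Hypothesis ev_word : forall v n (i : 'I_n.+1 -> nat) (j : 'I_n.+1 -> J),
  ev v (word mk i j) = wprod mul (fun k => tau (j k) (v (i k))).

Variable X : structure W.
Hypotheses (mulP : inv_tens X (mul_tens mul)) (tauP : forall j, inv_tens X (op_tens (tau j))).

Local Notation word := (word mk).

(* Junk value [0] on the empty family. *)
Definition wprod0 n : ('I_n -> W) -> W :=
  if n is n'.+1 then @wprod K W mul n' else fun=> 0.

Lemma eq_wprod0 n (f g : 'I_n -> W) : f =1 g -> wprod0 f = wprod0 g.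
Proof. by case: n f g => //= n f g; apply: eq_wprod. Qed.

Lemma wprod0_sumZ n (T : finType) (c : 'I_n -> T -> K) (F : 'I_n -> T -> W) :
  wprod0 (fun k => \sum_l c k l *: F k l) =
  \sum_(s : {ffun 'I_n -> T}) (\prod_k c k (s k)) *: wprod0 (fun k => F k (s k)).
Proof.
case: n c F => [|n] c F /=; first by rewrite big1 // => s _; rewrite scaler0.
rewrite (wprod_sum mul_linl mul_linr); apply: eq_bigr => s _.
by rewrite (wprodZ mul_linl mul_linr (fun k => c k (s k))).
Qed.

(** The empty word, where [ev] and [wprod0] may differ, has coefficient zero. *)
Lemma malg_ext_word (P : free_alg K A) v n (i : 'I_n -> nat) (j : 'I_n -> J) :
    P@_mone = 0 ->
  P@_(word i j) *: ev v (word i j) =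
  P@_(word i j) *: wprod0 (fun k => tau (j k) (v (i k))).
Proof.
case: n i j => [|n] i j P0; last by rewrite ev_word.
have -> : word i j = mone by apply/val_inj; rewrite /= fm1 enum_ord0.
by rewrite P0 !scale0r.
Qed.

(* The multilinear part of [P(v)], for [v_i = \sum_(u l = i) t^(B^l) z_l], is
   the coefficient of [t^(\sum_l B^l)]. *)
Lemma polarization (P : free_alg K A) n M (u : {ffun 'I_n -> 'I_M.+1}) (z : 'I_n -> W) N :
    P = \sum_(n < N) \sum_(i : {ffun 'I_n -> 'I_M.+1}) \sum_(j : {ffun 'I_n -> J})
        P@_(word (fun k => i k) j) *: << word (fun k => i k) j >> ->
    P@_mone = 0 -> (forall v, malg_ext (ev v) P = 0) -> (n < N)%N ->
  \sum_(s : 'S_n) \sum_(j : {ffun 'I_n -> J})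
     P@_(word (fun k => u (s k)) j) *: wprod0 (fun k => tau (j k) (z (s k))) = 0.
Proof.
move=> PE P0 evP nN; apply: crd_inj => b.
(* [B] exceeds the length of every monomial of [P], as [exponents_inj] demands; [p] below is the
   coordinate [b] of [P(v)] as a polynomial in [t]. *)
pose B := N.+1; pose e m (s : 'I_m -> 'I_n) := (\sum_k B ^ s k)%N.
have B_gt1 : (1 < B)%N := leq_ltn_trans (leq0n n) nN.
pose c m (s : {ffun 'I_m -> 'I_n}) (j : {ffun 'I_m -> J}) : K :=
  P@_(word (fun k => u (s k)) j) * crd b (wprod0 (fun k => tau (j k) (z (s k)))).
pose p : {poly K} := \sum_(m < N) \sum_(s : {ffun 'I_m -> 'I_n})
  \sum_(j : {ffun 'I_m -> J}) c m s j *: 'X^(e m s).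
have p0 : p = 0.
  apply: (poly_eq0_horner charK) => t.
  pose v i := \sum_(l < n) (t ^+ (B ^ l) *+ (i == u l :> nat)) *: z l.
  have := evP v; rewrite {1}PE (linearity_sum (malg_ext_linear _)).
  move/(congr1 (crd b)); rewrite [X in _ = X]/crd linear0 => <-.
  rewrite /p horner_sum /crd linear_sum; apply: eq_bigr => m _.
  rewrite horner_sum (linearity_sum (malg_ext_linear _)) linear_sum /=.
  (* Choosing the summand [s k] of [v] at each place [k] contributes only to the monomial with
     variables [u (s k)]. *)
  have prodE (s : {ffun 'I_m -> 'I_n}) (i : {ffun 'I_m -> 'I_M.+1}) :
      \prod_k (t ^+ (B ^ s k) *+ (i k == u (s k) :> nat)) =
      t ^+ e m s *+ (i == [ffun k => u (s k)]).
    case: eqP => [->|neq].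
      by under eq_bigr do rewrite ffunE eqxx; rewrite mulr1n prodrXr.
    have [k] : exists k, i k != u (s k).
      apply/existsP; rewrite -negb_forall; apply/negP => /forallP ius.
      by apply: neq; apply/ffunP => k; rewrite ffunE; apply/eqP.
    by rewrite -val_eqE => /negPf ik; rewrite (bigD1 k) //= ik mulr0n mul0r.
  have termE (i : {ffun 'I_m -> 'I_M.+1}) :
      coord (vbasis {:W}) b (malg_ext (ev v) (\sum_(j : {ffun 'I_m -> J})
        P@_(word (fun k => i k) j) *: << word (fun k => i k) j >>)) =
      \sum_(s : {ffun 'I_m -> 'I_n}) \sum_(j : {ffun 'I_m -> J})
        P@_(word (fun k => i k) j) * (t ^+ e m s *+ (i == [ffun k => u (s k)])) *
        crd b (wprod0 (fun k => tau (j k) (z (s k)))).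
    rewrite exchange_big (linearity_sum (malg_ext_linear _)) linear_sum.
    apply: eq_bigr => j _.
    rewrite (linearityZ (malg_ext_linear _)) malg_extU malg_ext_word //.
    have -> : wprod0 (fun k => tau (j k) (v (i k))) = wprod0 (fun k : 'I_m =>
        \sum_(l < n) (t ^+ (B ^ l) *+ (i k == u l :> nat)) *: tau (j k) (z l)).
      apply: eq_wprod0 => k; rewrite (linearity_sum (tau_lin _)).
      by apply: eq_bigr => l _; rewrite (linearityZ (tau_lin _)).
    rewrite wprod0_sumZ scaler_sumr linear_sum; apply: eq_bigr => s _.
    by rewrite prodE scalerA linearZ.
  rewrite (eq_bigr _ (fun i _ => termE i)) exchange_big; apply: eq_bigr => s _.
  rewrite (bigD1 [ffun k => u (s k)]) //= [X in _ + X]big1 ?addr0 => [|i /negPf->]; last first.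
    by rewrite big1 // => j _; rewrite mulr0 mul0r.
  rewrite horner_sum; apply: eq_bigr => j _.
  rewrite hornerZ hornerXn /c eqxx mulrAC; congr (_ * _ * _).
  by congr (P@__); apply: eq_word => // k; rewrite ffunE.
(* By [exponents_inj], only length [n] and injective [s] contribute to this coefficient; these [s]
   are the permutations. *)
have {p0} : p`_(\sum_(l < n) B ^ l) = 0 by rewrite p0 coef0.
rewrite /p coef_sum (bigD1 (Ordinal nN)) //= [X in _ + X]big1 ?addr0 => [|m neq]; last first.
  rewrite coef_sum big1 // => s _; rewrite coef_sum big1 // => j _.
  rewrite coefZ coefXn; case: eqP => [es|_]; last by rewrite mulr0.
  have [mn _] := exponents_inj (ltnW (ltn_ord m) : m < B)%N B_gt1 (esym es).
  by move/eqP: neq => []; apply: val_inj.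
move=> p_coef; rewrite [RHS]/crd linear0 -[RHS]p_coef coef_sum /crd linear_sum /=.
rewrite [RHS](bigID (fun s : {ffun 'I_n -> 'I_n} => injectiveb s)) /=.
rewrite [X in _ = _ + X]big1 ?addr0 => [|s s_inj]; last first.
  rewrite coef_sum big1 // => j _; rewrite coefZ coefXn.
  case: eqP => [es|_]; last by rewrite mulr0.
  by have [_ /injectiveP] := exponents_inj (ltnW nN : n < B)%N B_gt1 (esym es);
    rewrite (negbTE s_inj).
rewrite (reindex_onto (fun s : 'S_n => pval s) (fun s => insubd (1%g : 'S_n) s)) /=; last first.
  by move=> s s_inj; rewrite -[pval _]/(val _) insubdK.
have permT (s : 'S_n) : injectiveb (pval s) && (insubd (1%g : 'S_n) (pval s) == s).
  by rewrite (valP s) -[pval s]/(val s) valKd eqxx.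
rewrite [RHS](eq_bigl xpredT) //; apply: eq_bigr => s _.
rewrite coef_sum linear_sum; apply: eq_bigr => j _.
rewrite coefZ coefXn linearZ.
have -> : e n (pval s) = (\sum_(l < n) B ^ l)%N.
  by rewrite [RHS](reindex_inj (@perm_inj _ s)); apply: eq_bigr => k _; rewrite pvalE.
rewrite eqxx mulr1 /c; congr (P@_ _ * crd b _).
  by apply: eq_word => // k; rewrite pvalE.
by apply: eq_wprod0 => k; rewrite pvalE.
Qed.

Definition identity (P : free_alg K A) : Prop :=
  P@_mone = 0 /\ forall v, malg_ext (ev v) P = 0.

Section Multilinear.
Variable n : nat.
Let T : finType := ('S_n.+1 * {ffun 'I_n.+1 -> J})%type.

(** The tensor of the multilinear map that sends [z] to the product of the
    [tau (t.2 k) (z (t.1 k))]. *)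
Definition perm_tens (t : T) : tens W 1 n.+1 :=
  tens_perm 1 t.1 (prod_tens mul (fun k => tau (t.2 k))).

Lemma inv_perm_tens t : inv_tens X (perm_tens t).
Proof. by apply/inv_perm/inv_prod_tens => // k. Qed.

Lemma perm_tensE t i (L : 'I_n.+1 -> 'I_(\dim {:W})) :
  perm_tens t ([tuple i], [tuple L k | k < n.+1]) =
  crd i (wprod mul (fun k => tau (t.2 k) (bas (L (t.1 k))))).
Proof.
rewrite !ffunE /=; apply: congr2; first by rewrite tnth_mktuple perm1 (tnth_nth i).
by apply: eq_wprod => k; rewrite !tnth_mktuple.
Qed.

(** The components of the relation are its values on basis vectors; multilinearity extends it to all
    [z]. *)
Lemma perm_tens_rel (a : T -> K) : \sum_t a t *: perm_tens t = 0 ->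
  forall z : 'I_n.+1 -> W,
    \sum_t a t *: wprod mul (fun k => tau (t.2 k) (z (t.1 k))) = 0.
Proof.
move=> a0 z.
have wE (t : T) : wprod mul (fun k => tau (t.2 k) (z (t.1 k))) =
    \sum_(L : {ffun 'I_n.+1 -> 'I_(\dim {:W})}) (\prod_k crd (L k) (z k)) *:
      wprod mul (fun k => tau (t.2 k) (bas (L (t.1 k)))).
  rewrite (wprod_bas mul_linl mul_linr (theta := fun k => tau (t.2 k))
    (fun k => z (t.1 k))); last by move=> k; apply: tau_lin.
  rewrite (reindex _ (onW_bij _ (ffun_perm_bij _ t.1))).
  apply: eq_bigr => L _; congr (_ *: _).
    by rewrite [RHS](reindex_inj (@perm_inj _ t.1)); apply: eq_bigr => k _; rewrite ffunE.
  by apply: eq_wprod => k; rewrite ffunE.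
under eq_bigr do rewrite wE scaler_sumr.
rewrite exchange_big big1 //= => L _.
under eq_bigr do rewrite scalerA mulrC -scalerA.
rewrite -scaler_sumr; apply/eqP; rewrite scaler_eq0; apply/orP; right; apply/eqP.
apply: crd_inj => i; move/ffunP/(_ ([tuple i], [tuple L k | k < n.+1])): a0.
rewrite sum_ffunE ffunE => {}a0; rewrite crd_sumZ [RHS]/crd linear0 -[RHS]a0.
by apply: eq_bigr => t _; rewrite ffunE perm_tensE.
Qed.

(** The hypothesis makes [a] a relation between the invariant tensors [perm_tens t]. Each row [R s]
    spanning it is a multilinear identity, and renaming its variables by [u] keeps it an
    identity. *)
Lemma multilinear_spanned M (u : {ffun 'I_n.+1 -> 'I_M.+1}) (a : T -> K) :
    (forall z : 'I_n.+1 -> W,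
      \sum_t a t *: wprod mul (fun k => tau (t.2 k) (z (t.1 k))) = 0) ->
  spanned (scalar_mor X) identity
    (\sum_t a t *: << word (fun k => u (t.1 k)) t.2 >>).
Proof.
move=> az.
have [|R [RK R0 aR]] := @relations_scalar_mor_fin _ _ X T _ _ perm_tens a inv_perm_tens.
  apply/ffunP => -[B C]; rewrite sum_ffunE ffunE.
  have := az (fun k => bas (tnth C k)) => /(congr1 (crd (tnth B ord0))).
  rewrite crd_sumZ [X in _ = X]/crd linear0 => az0; rewrite -[RHS]az0.
  apply: eq_bigr => t _.
  rewrite ffunE -perm_tensE; congr (_ * perm_tens t (_, _)).
    by apply: eq_from_tnth => k; rewrite (ord1 k) [RHS](tnth_nth (tnth B ord0)).
  by apply: eq_from_tnth => k; rewrite tnth_mktuple.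
pose w (t : T) := word (fun k => u (t.1 k)) t.2.
have -> : \sum_t a t *: << w t >> = \sum_s a s *: \sum_t R s t *: << w t >>.
  under [RHS]eq_bigr do rewrite scaler_sumr.
  rewrite exchange_big; apply: eq_bigr => t _; rewrite {1}aR scaler_suml.
  by apply: eq_bigr => s _; rewrite scalerA.
apply: spanned_sum => s _; apply: spanned_scale; last first.
  move=> m; rewrite raddf_sum; apply: scalar_mor_sum => t _ /=.
  rewrite mcoeffZ mcoeffU1; case: eqP; rewrite ?mulr1 ?mulr0 // => _.
  exact: scalar_mor0.
split.
  rewrite raddf_sum big1 //= => t _; rewrite mcoeffZ mcoeffU1.
  case: eqP => [/(congr1 (fun m : {fmonom A} => size m))|_]; last exact: mulr0.
  by rewrite size_word fm1.
move=> v; rewrite (linearity_sum (malg_ext_linear _)).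
rewrite -[RHS](perm_tens_rel (R0 s) (fun k => v (u k))); apply: eq_bigr => t _.
by rewrite (linearityZ (malg_ext_linear _)) malg_extU ev_word.
Qed.

End Multilinear.

Theorem identities_spanned P : identity P -> spanned (scalar_mor X) identity P.
Proof.
case=> P0 evP; have [N [M PE]] := malg_words mkK var_mk typ_mk P.
rewrite PE; apply: spanned_sum => -[[|n] nN] _ /=.
  rewrite big1 => [|i _]; first exact: spanned0.
  rewrite big1 // => j _.
  have -> : word (fun k => i k) j = mone by apply/val_inj; rewrite /= fm1 enum_ord0.
  by rewrite P0 scale0r.
pose H (i : {ffun 'I_n.+1 -> 'I_M.+1}) := \sum_(j : {ffun 'I_n.+1 -> J})
  P@_(word (fun k => i k) j) *: << word (fun k => i k) j >> : free_alg K A.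
pose f : K := (n.+1)`!%:R.
have f_neq0 : f != 0 by rewrite /f (pcharf0P _).1 // -lt0n fact_gt0.
(* Each [s] merely permutes the functions [u], so the double sum counts every [H i] exactly [n.+1]
   factorial times. *)
have -> : \sum_i H i = f^-1 *: \sum_(u : {ffun 'I_n.+1 -> 'I_M.+1})
    \sum_(s : 'S_n.+1) H [ffun k => u (s k)].
  rewrite [in RHS]exchange_big [X in _ *: X](eq_bigr (fun=> \sum_i H i)) => [|s _].
    by rewrite sumr_const card_Sn -scaler_nat scalerA mulVf // scale1r.
  by rewrite [RHS](reindex _ (onW_bij _ (ffun_perm_bij _ s))).
apply: spannedZ; apply: spanned_sum => u _.
have -> : \sum_(s : 'S_n.+1) H [ffun k => u (s k)] =
    \sum_(t : 'S_n.+1 * {ffun 'I_n.+1 -> J})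
      P@_(word (fun k => u (t.1 k)) t.2) *: << word (fun k => u (t.1 k)) t.2 >>.
  rewrite -(pair_bigA _ (fun (s : 'S_n.+1) (j : {ffun 'I_n.+1 -> J}) =>
     P@_(word (fun k => u (s k)) j) *: << word (fun k => u (s k)) j >>)).
  apply: eq_bigr => s _; apply: eq_bigr => j _ /=.
  by rewrite (@eq_word _ _ _ _ _ (fun k => u (s k)) _ j) // => k; rewrite ffunE.
(* For fixed [u], the sum over [s] comes from a multilinear polynomial by substitution, and
   [polarization] makes that polynomial an identity. *)
apply: multilinear_spanned => z.
rewrite -[RHS](polarization u z PE P0 evP nN).
by rewrite pair_bigA.
Qed.

End Identities.

(** * Integrals of finite-dimensional Hopf algebras *)

Section Hopf.
Variables (k : fieldType) (H : falgType k) (hH : hopf H).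

Local Notation S := (antipode hH).
Local Notation eps := (eps hH).
Local Notation Delta := (Delta hH).

(* [F] applied to the Sweedler components [h_1], [h_2] of [h]. *)
Definition sw (V : lmodType k) (h : H) (F : H -> H -> V) : V :=
  \sum_i F (Delta h i) (bas i).

Lemma Delta_coassocE h i j :
  Delta (Delta h j) i = \sum_l crd i (Delta (bas l) j) *: Delta h l.
Proof.
have /ffunP/(_ j)/ffunP/(_ i) := Delta_coassoc hH h.
by rewrite !ffunE sum_ffunE => ->; apply: eq_bigr => l _; apply: ffunE.
Qed.

(** * Sweedler calculus *)

Section Sweedler.
Variable V : lmodType k.
Implicit Types (F : H -> H -> V) (f : H -> V).

Lemma eq_sw h F G : (forall a b, F a b = G a b) -> sw h F = sw h G.
Proof. by move=> FG; apply: eq_bigr => i _; apply: FG. Qed.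

Lemma sw_lin F : (forall b, linear (F^~ b)) -> linear (fun h => sw h F).
Proof.
move=> F_lin c x y; rewrite /sw scaler_sumr -big_split; apply: eq_bigr => i _ /=.
by rewrite linearP !ffunE F_lin.
Qed.

Lemma lin_sw h (G : H -> H -> H -> V) : (forall a b, linear (fun x => G x a b)) ->
  linear (fun x => sw h (G x)).
Proof.
move=> G_lin c x y; rewrite /sw scaler_sumr -big_split; apply: eq_bigr => i _ /=.
by rewrite G_lin.
Qed.

Lemma sw_coassoc h (F : H -> H -> H -> V) :
    (forall b c, linear (fun a => F a b c)) -> (forall a c, linear (fun b => F a b c)) ->
  sw h (fun a c => sw a (fun a1 a2 => F a1 a2 c)) =
  sw h (fun a b => sw b (fun b1 b2 => F a b1 b2)).
Proof.
move=> F1 F2.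
rewrite /sw [RHS]exchange_big /=; apply: eq_bigr => j _.
transitivity (\sum_l \sum_i F (Delta h l) (crd i (Delta (bas l) j) *: bas i) (bas j)).
  rewrite exchange_big; apply: eq_bigr => i _; rewrite Delta_coassocE.
  rewrite (linearity_sum (F1 _ _)); apply: eq_bigr => l _.
  by rewrite (linearityZ (F1 _ _)) (linearityZ (F2 _ _)).
apply: eq_bigr => l _; rewrite [X in _ = F _ X _](sum_crd (Delta (bas l) j)).
by rewrite (linearity_sum (F2 _ _)).
Qed.

Lemma sw_mul g h F :
    (forall b, linear (F^~ b)) -> (forall a, linear (F a)) ->
  sw (g * h) F = sw g (fun a b => sw h (fun c d => F (a * c) (b * d))).
Proof.
move=> F1 F2; rewrite /sw DeltaM /mulH.
transitivity (\sum_l \sum_i \sum_j F (Delta g i * Delta h j) (crd l (bas i * bas j) *: bas l)).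
  apply: eq_bigr => l _; rewrite sum_ffunE (linearity_sum (F1 _)).
  apply: eq_bigr => i _; rewrite sum_ffunE (linearity_sum (F1 _)).
  by apply: eq_bigr => j _; rewrite ffunE (linearityZ (F1 _)) (linearityZ (F2 _)).
rewrite exchange_big; apply: eq_bigr => i _; rewrite exchange_big; apply: eq_bigr => j _.
by rewrite [X in _ = F _ X]sum_crd (linearity_sum (F2 _)).
Qed.

Lemma sw_counitl h f : linear f -> sw h (fun a b => (eps a : k) *: f b) = f h.
Proof.
move=> f_lin; rewrite -{2}(eps_counitl hH h) (linearity_sum f_lin).
by apply: eq_bigr => i _; rewrite (linearityZ f_lin).
Qed.

Lemma sw_counitr h f : linear f -> sw h (fun a b => (eps b : k) *: f a) = f h.
Proof.
move=> f_lin; rewrite -{2}(eps_counitr hH h) (linearity_sum f_lin).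
by apply: eq_bigr => i _; rewrite (linearityZ f_lin).
Qed.

Lemma sw_swap g h (F : H -> H -> H -> H -> V) :
  sw g (fun a b => sw h (fun c d => F a b c d)) =
  sw h (fun c d => sw g (fun a b => F a b c d)).
Proof. exact: exchange_big. Qed.

End Sweedler.

Lemma sw_app (U V : lmodType k) (L : U -> V) h (F : H -> H -> U) : linear L ->
  L (sw h F) = sw h (fun a b => L (F a b)).
Proof. by move=> L_lin; rewrite /sw (linearity_sum L_lin). Qed.

Lemma sw_antipodel h : sw h (fun a b => S a * b) = (eps h : k) *: 1.
Proof. exact: antipodel. Qed.

Lemma sw_antipoder h : sw h (fun a b => a * S b) = (eps h : k) *: 1.
Proof. exact: antipoder. Qed.

Ltac lin := move=> ? ? ?;
  rewrite ?(mulrDl, mulrDr, scalerDl, scalerDr, =^~ scalerAl, =^~ scalerAr, linearP) //.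

(** * The antipode on units and products, and left integrals *)

Lemma antipode1 : S 1 = 1.
Proof.
have := sw_antipodel 1; rewrite eps1 scale1r /sw Delta1 => e; rewrite -[RHS]e.
rewrite -{1}[S 1]mulr1 {2}[1](sum_crd (1 : H)) mulr_sumr; apply: eq_bigr => i _.
by rewrite ffunE linearZ /= -scalerAl -scalerAr.
Qed.

(* Both sides are values of [S(g_1 h_1) g_2 h_2 S(h_3) S(g_3)]. *)
Lemma antipodeM g h : S (g * h) = S h * S g.
Proof.
pose Phi (g1 g2 g3 h1 h2 h3 : H) : H := S (g1 * h1) * (g2 * h2 * S h3 * S g3).
pose Z := sw g (fun g1 g' => sw g' (fun g2 g3 =>
  sw h (fun h1 h' => sw h' (fun h2 h3 => Phi g1 g2 g3 h1 h2 h3)))).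
(* Collapse [h2 * S h3] first, then [g2 * S g3]. *)
have ZL : Z = S (g * h).
  transitivity (sw g (fun g1 g' => sw g' (fun g2 g3 => S (g1 * h) * (g2 * S g3)))).
    apply: eq_sw => g1 g'; apply: eq_sw => g2 g3.
    rewrite -(@sw_counitr _ h (fun h => S (g1 * h) * (g2 * S g3))); last by lin.
    apply: eq_sw => h1 h'.
    have L : linear (fun x => S (g1 * h1) * (g2 * x * S g3)) by lin.
    rewrite -[g2]mulr1 -(linearityZ L) -sw_antipoder (sw_app _ _ L).
    by apply: eq_sw => h2 h3; rewrite /Phi mulr1 !mulrA.
  rewrite -(@sw_counitr _ g (fun g => S (g * h))); last by lin.
  apply: eq_sw => g1 g'; have L : linear (fun x => S (g1 * h) * x) by lin.
  by rewrite -(sw_app _ _ L) sw_antipoder (linearityZ L) mulr1.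
(* Regrouped by coassociativity, [S (g1 * h1) * (g2 * h2)] is the antipode law at a product and
   collapses to a counit, leaving [S h3 * S g3]. *)
rewrite -ZL /Z -(@sw_coassoc _ g (fun g1 g2 g3 => sw h (fun h1 h' =>
  sw h' (fun h2 h3 => Phi g1 g2 g3 h1 h2 h3)))); first last.
- by move=> g1 g3; do 2![apply: lin_sw => ? ?]; rewrite /Phi; lin.
- by move=> g2 g3; do 2![apply: lin_sw => ? ?]; rewrite /Phi; lin.
transitivity (sw g (fun a g3 => (eps a : k) *: sw h (fun b h3 =>
    (eps b : k) *: (S h3 * S g3)))); last first.
  rewrite (@sw_counitl _ g (fun x => sw h (fun b h3 => (eps b : k) *: (S h3 * S x)))).
    by apply: (@sw_counitl _ h (fun x => S x * S g)); lin.
  by apply: lin_sw => ? ?; lin; rewrite !scalerA mulrC.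
apply: eq_sw => a g3; rewrite (sw_app _ _ (fun c => _)); last by lin; rewrite !scalerA mulrC.
transitivity (sw a (fun g1 g2 => sw h (fun b h3 => sw b (fun h1 h2 => Phi g1 g2 g3 h1 h2 h3)))).
  apply: eq_sw => g1 g2; rewrite sw_coassoc //; first by move=> ? ?; rewrite /Phi; lin.
  by move=> ? ?; rewrite /Phi; lin.
rewrite sw_swap; apply: eq_sw => b h3.
have L : linear (fun x => x * (S h3 * S g3)) by lin.
transitivity (sw (a * b) (fun u v => S u * v * (S h3 * S g3))).
  rewrite sw_mul; first by apply: eq_sw => u v; apply: eq_sw => u' v'; rewrite /Phi !mulrA.
    by move=> ?; lin.
  by move=> ?; lin.
by rewrite -(sw_app _ _ L) sw_antipodel (linearityZ L) epsM mul1r scalerA.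
Qed.


(* [h_1 (x) S(h_3) S^2(h_2) = h (x) 1]. *)
Lemma antipode_shift (V : lmodType k) h y (F : H -> H -> V) :
    (forall b, linear (F^~ b)) -> (forall a, linear (F a)) ->
  sw h (fun h' h3 => sw (h' * y) (fun a b => F a (S h3 * S (S b)))) =
  sw y (fun a b => F (h * a) (S (S b))).
Proof.
move=> F1 F2.
have linF a c : linear (fun b => F a (c * S (S b))).
  by move=> ? ? ?; rewrite !linearP mulrDr -scalerAr F2.
transitivity (sw h (fun h' h3 => sw h' (fun h1 h2 => sw y (fun a b =>
    F (h1 * a) (S (S h2 * h3) * S (S b)))))).
  apply: eq_sw => h' h3; rewrite sw_mul //.
  by apply: eq_sw => h1 h2; apply: eq_sw => a b; rewrite !antipodeM mulrA.
rewrite (@sw_coassoc _ h (fun h1 h2 h3 => sw y (fun a b =>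
    F (h1 * a) (S (S h2 * h3) * S (S b))))); first last.
- move=> a c; apply: lin_sw => ? ? ? ? ?.
  by rewrite linearP mulrDl -scalerAl linearP mulrDl -scalerAl F2.
- by move=> b c; apply: lin_sw => ? ? ? ? ?; rewrite mulrDl -scalerAl F1.
rewrite -(@sw_counitr _ h (fun h => sw y (fun a b => F (h * a) (S (S b))))); last first.
  by apply: lin_sw => ? ? ? ? ?; rewrite mulrDl -scalerAl F1.
apply: eq_sw => h1 h2.
have L : linear (fun z => sw y (fun a b => F (h1 * a) (S z * S (S b)))).
  by apply: lin_sw => ? ? ? ? ?; rewrite linearP mulrDl -scalerAl F2.
rewrite -(sw_app h2 (fun a b => S a * b) L) sw_antipodel (linearityZ L).
by congr (_ *: _); apply: eq_sw => a b; rewrite antipode1 mul1r.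
Qed.

(** The partial trace, over the second tensor factor, of the map from [H] to [H (x) H] sending [y]
    to [a (x) S (S b)], with [a], [b] the Sweedler components of [y * x]. *)
Definition integral_proj (x : H) : H :=
  \sum_i sw (bas i * x) (fun a b => crd i (S (S b)) *: a).

Lemma crd_linear i : linear (crd i : H -> k^o).
Proof. by move=> c u v; rewrite /crd linearP. Qed.

(** [antipode_shift] replaces [h] by a factor [h'] inside the argument [bas i * x] and a factor
    [S h3] on the traced side. Cyclicity of the trace moves [h'] next to [S h3], and [h' * S h3]
    collapses to the counit. *)
Lemma integral_projP h x : h * integral_proj x = (eps h : k) *: integral_proj x.
Proof.
pose G i (a b : H) : H := crd i b *: a.
have G1 i b : linear ((G i)^~ b) by move=> c u v; rewrite /G scalerDr !scalerA mulrC.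
have G2 i a : linear (G i a).
  by move=> c u v; rewrite /G crd_linear scalerDl scalerA.
transitivity (\sum_i sw h (fun h' h3 => sw (h' * (bas i * x))
    (fun a b => G i a (S h3 * S (S b))))).
  rewrite mulr_sumr; apply: eq_bigr => i _; rewrite (antipode_shift h _ (G1 i) (G2 i)).
  have L : linear (fun y => h * y) by lin.
  by rewrite (sw_app _ _ L); apply: eq_sw => a b; rewrite /G -scalerAr.
have swL i h3 : linear (fun y => sw y (fun a b => G i a (S h3 * S (S b)))).
  by apply: sw_lin => b; apply: G1.
transitivity (sw h (fun h' h3 => \sum_j sw (bas j * x)
    (fun a b => G j a (h' * S h3 * S (S b))))).
  rewrite exchange_big /=; apply: eq_bigr => l _.
  move: (Delta h l) (bas l) => h' h3.
  transitivity (\sum_i \sum_j crd j (h' * bas i) *: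
      sw (bas j * x) (fun a b => G i a (S h3 * S (S b)))).
    apply: eq_bigr => i _; rewrite mulrA {1}[h' * bas i]sum_crd mulr_suml.
    rewrite (linearity_sum (swL _ _)); apply: eq_bigr => j _.
    by rewrite -scalerAl (linearityZ (swL _ _)).
  rewrite exchange_big; apply: eq_bigr => j _.
  rewrite /sw; under eq_bigr do rewrite scaler_sumr.
  rewrite exchange_big; apply: eq_bigr => m _; move: (Delta _ m) (S (S _)) => a b.
  rewrite /G; under eq_bigr do rewrite scalerA.
  rewrite -scaler_suml; congr (_ *: _).
  rewrite -mulrA {2}[S h3 * b]sum_crd mulr_sumr.
  under [in RHS]eq_bigr do rewrite -scalerAr.
  by rewrite crd_sumZ; apply: eq_bigr => i _; rewrite mulrC.
have L : linear (fun z => \sum_j sw (bas j * x) (fun a b => G j a (z * S (S b)))).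
  move=> c u v; rewrite scaler_sumr -big_split; apply: eq_bigr => j _.
  by apply: (@lin_sw _ _ (fun z a b => G j a (z * S (S b)))) => a b ? ? ?;
    rewrite mulrDl -scalerAl G2.
rewrite -(sw_app h (fun a b => a * S b) L) sw_antipoder (linearityZ L).
congr (_ *: _); apply: eq_bigr => j _; apply: eq_sw => a b.
by rewrite mul1r.
Qed.

(* The trace of [S \o integral_proj] is [1]. *)
Lemma integral_proj_neq0 : exists x, integral_proj x != 0.
Proof.
have tr : \sum_j crd j (S (integral_proj (bas j))) = 1 :> k.
  transitivity (\sum_m crd m (sw (bas m) (fun a b => S (S b) * S a))).
    transitivity (\sum_j \sum_i \sum_m \sum_l crd m (bas i * bas j) *
        (crd i (S (S (bas l))) * crd j (S (Delta (bas m) l)))).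
      apply: eq_bigr => j _; rewrite /integral_proj linear_sum /crd linear_sum.
      apply: eq_bigr => i _; rewrite -/(crd j _).
      have L : linear (fun y => @sw k^o y (fun a b => crd i (S (S b)) * crd j (S a))).
        by apply: sw_lin => b c u v; rewrite linearP crd_linear mulrDr mulrCA.
      transitivity (@sw k^o (bas i * bas j) (fun a b => crd i (S (S b)) * crd j (S a))).
        rewrite /sw linear_sum /crd linear_sum; apply: eq_bigr => l _.
        by rewrite !linearZ.
      rewrite {1}[bas i * bas j]sum_crd (linearity_sum L); apply: eq_bigr => m _.
      by rewrite (linearityZ L) /sw scaler_sumr.
    rewrite exchange_big /=; under eq_bigr do rewrite exchange_big /=.
    rewrite exchange_big /=; apply: eq_bigr => m _.
    rewrite /sw /crd linear_sum -/crd.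
    under eq_bigr do rewrite exchange_big /=.
    rewrite exchange_big; apply: eq_bigr => l _ /=.
    rewrite {2}[S (S (bas l))]sum_crd mulr_suml linear_sum; apply: eq_bigr => i _.
    rewrite {2}[S (Delta (bas m) l)]sum_crd mulr_sumr linear_sum; apply: eq_bigr => j _.
    by rewrite -scalerAl -scalerAr !linearZ /= mulrC -mulrA.
  (* As [S] reverses products, [S (S b) * S a] is [S (a * S b)], which collapses to a counit; the
     remaining sum is [eps 1]. *)
  transitivity (\sum_m crd m (1 : H) * (eps (bas m) : k)).
    apply: eq_bigr => m _.
    have -> : sw (bas m) (fun a b => S (S b) * S a) = S (sw (bas m) (fun a b => a * S b)).
      by rewrite (sw_app _ _ (linearP S)); apply: eq_sw => a b; rewrite /= antipodeM.
    by rewrite sw_antipoder linearZ /= antipode1 /crd linearZ mulrC.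
  rewrite -[RHS](eps1 hH) {2}[1](sum_crd (1 : H)) linear_sum.
  by apply: eq_bigr => m _; rewrite linearZ.
case: (boolP [exists i, integral_proj (bas i) != 0]) => [/existsP[i Pi]|].
  by exists (bas i).
rewrite negb_exists => /forallP P0.
move/eqP: tr; rewrite big1 ?(eq_sym 0) ?oner_eq0 // => i _.
have /negPn/eqP -> := P0 i.
by rewrite /crd !linear0.
Qed.

(** * A nonzero left integral generates [H] over its dual *)

Section Integral.
Variable t : H.
Hypotheses (tP : forall h, h * t = (eps h : k) *: t) (t_neq0 : t != 0).

(* [1 (x) h = (S(h_1) (x) 1) Delta(h_2)], and [Delta(h_2 t) = eps(h_2) Delta(t)]. *)
Lemma integral_shift (V : lmodType k) h (F : H -> H -> V) :
    (forall b, linear (F^~ b)) -> (forall a, linear (F a)) ->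
  sw t (fun a b => F a (h * b)) = sw t (fun a b => F (S h * a) b).
Proof.
move=> F1 F2.
pose G p q h3 := sw t (fun a b => F (S p * q * a) (h3 * b)).
transitivity (sw h (fun h' h3 => sw h' (fun p q => G p q h3))).
  rewrite -(@sw_counitl _ h (fun h => sw t (fun a b => F a (h * b)))); last first.
    by apply: lin_sw => ? ? ? ? ?; rewrite mulrDl -scalerAl F2.
  apply: eq_sw => h' h3.
  have L : linear (fun z => sw t (fun a b => F (z * a) (h3 * b))).
    by apply: lin_sw => ? ? ? ? ?; rewrite mulrDl -scalerAl F1.
  rewrite -(sw_app h' (fun p q => S p * q) L) sw_antipodel (linearityZ L).
  by congr (_ *: _); apply: eq_sw => a b; rewrite mul1r.
rewrite (@sw_coassoc _ h G); first last.
- by move=> p h3; apply: lin_sw => ? ? ? ? ?; rewrite mulrDr mulrDl -scalerAr -scalerAl F1.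
- by move=> q h3; apply: lin_sw => ? ? ? ? ?; rewrite linearP !mulrDl -!scalerAl F1.
rewrite -(@sw_counitr _ h (fun h => sw t (fun a b => F (S h * a) b))); last first.
  by apply: lin_sw => ? ? ? ? ?; rewrite linearP mulrDl -scalerAl F1.
apply: eq_sw => p h''.
have L : linear (fun y => sw y (fun a b => F (S p * a) b)).
  by apply: sw_lin => ? ? ? ?; rewrite mulrDr -scalerAr F1.
rewrite -(linearityZ L) -tP sw_mul //; last first.
  by move=> ? ? ? ?; rewrite mulrDr -scalerAr F1.
by apply: eq_sw => q h3; apply: eq_sw => a b; rewrite mulrA.
Qed.

Lemma integral_translate (g : H -> k^o) h : linear g ->
  sw t (fun a b => g b *: a) = 0 -> sw t (fun a b => g (h * b) *: a) = 0.
Proof.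
move=> g_lin g0; rewrite (@integral_shift _ h (fun a b => g b *: a)); first last.
- by move=> a c u v; rewrite g_lin scalerDl scalerA.
- by move=> b c u v; rewrite scalerDr !scalerA mulrC.
have L : linear (fun x => S h * x) by lin.
rewrite -[RHS](linearity0 L) -g0 (sw_app _ _ L).
by apply: eq_sw => a b; rewrite -scalerAr.
Qed.

(* The functionals [g] with [t_1 g(t_2) = 0] are stable under translations and
   form a left ideal of [H^*], so they contain [\sum_i (e^i \o S) * g(e_i -)],
   which is [g(1) eps]. *)
Lemma integral_generator (f : H -> k^o) : linear f ->
  sw t (fun a b => f b *: a) = 0 -> forall h, f h = 0.
Proof.
move=> f_lin f0.
(* The value at 1 suffices, because [x |-> f (h * x)] satisfies the same hypothesis by
   [integral_translate]. *)
have f1 (g : H -> k^o) : linear g -> sw t (fun a b => g b *: a) = 0 -> g 1 = 0.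
  move=> g_lin g0.
  pose w i (x : H) : k^o := @sw k^o x (fun a b => crd i (S a) * g (bas i * b)).
  have w0 i : sw t (fun p x => w i x *: p) = 0.
    have L : linear (fun c => sw c (fun p a => crd i (S a) *: p)).
      by apply: sw_lin => ? ? ? ?; rewrite scalerDr !scalerA mulrC.
    transitivity (sw t (fun p x => sw x (fun a b => (crd i (S a) * g (bas i * b)) *: p))).
      by apply: eq_sw => p x; rewrite /w /sw scaler_suml.
    rewrite -(@sw_coassoc _ t (fun p a b => (crd i (S a) * g (bas i * b)) *: p)); first last.
    - by move=> p b c u v; rewrite linearP crd_linear mulrDl scalerDl scalerA mulrA.
    - by move=> a b c u v; rewrite scalerDr !scalerA mulrC.
    rewrite -[RHS](linearity0 L) -(integral_translate (bas i) g_lin g0) (sw_app _ _ L).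
    apply: eq_sw => c b; rewrite (linearityZ L) /sw scaler_sumr.
    by apply: eq_bigr => l _; rewrite scalerA mulrC.
  have wE x : \sum_i w i x = (eps x : k) * g 1.
    transitivity (@sw k^o x (fun a b => g (S a * b))).
      rewrite /w /sw exchange_big; apply: eq_bigr => l _ /=.
      rewrite [in RHS](sum_crd (S (Delta x l))) mulr_suml (linearity_sum g_lin).
      by apply: eq_bigr => i _; rewrite -scalerAl (linearityZ g_lin).
    by rewrite -(sw_app x (fun a b => S a * b) g_lin) sw_antipodel (linearityZ g_lin).
  have : g 1 *: t = 0.
    rewrite -(@sw_counitr _ t (fun x => g 1 *: x)); last first.
      by move=> c u v; rewrite scalerDr !scalerA mulrC.
    transitivity (\sum_i sw t (fun p x => w i x *: p)); last by rewrite big1.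
    rewrite exchange_big; apply: eq_bigr => l _ /=.
    by rewrite -scaler_suml wE scalerA.
  by move/eqP; rewrite scaler_eq0 (negbTE t_neq0) orbF => /eqP.
move=> h; rewrite -[h]mulr1; apply: (f1 (fun x => f (h * x))).
  by move=> c u v; rewrite mulrDr -scalerAr f_lin.
exact: integral_translate.
Qed.

End Integral.

(* [H] is free of rank one over [H^*], with generator [t]; row [j] of [F] is the
   functional taking [t] to [bas j]. *)
Lemma free_rank1 : exists (t : H) (F : 'M[k]_(\dim {:H})),
  (forall j, \sum_i F j i *: Delta t i = bas j) /\
  (forall v : 'I_(\dim {:H}) -> k, \sum_i v i *: Delta t i = 0 -> forall i, v i = 0).
Proof.
have [x x0] := integral_proj_neq0.
pose t := integral_proj x; exists t.
have t_inj (v : 'I_(\dim {:H}) -> k) : \sum_i v i *: Delta t i = 0 -> forall i, v i = 0.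
  move=> v0 i; pose f (h : H) : k^o := \sum_j crd j h *: (v j : k^o).
  have fE j : f (bas j) = v j.
    rewrite /f (bigD1 j) //= crd_bas eqxx scale1r big1 ?addr0 // => l /negPf lj.
    by rewrite crd_bas lj scale0r.
  rewrite -fE; apply: (integral_generator (t := t) (fun h => integral_projP h x) x0).
    move=> c u w; rewrite /f scaler_sumr -big_split; apply: eq_bigr => j _ /=.
    by rewrite crd_linear scalerDl scalerA.
  by rewrite -[RHS]v0; apply: eq_bigr => j _; rewrite fE.
(* The matrix of [f |-> t_1 f(t_2)]; it is square, so injectivity makes it invertible. *)
pose M := \matrix_(i, l) crd l (Delta t i).
have rowM (v : 'rV_(\dim {:H})) l : (v *m M) 0 l = crd l (\sum_i v 0 i *: Delta t i).
  by rewrite mxE crd_sumZ; apply: eq_bigr => i _; rewrite mxE.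
have M_unit : M \in unitmx.
  rewrite -row_free_unit; apply: inj_row_free => v vM0.
  apply/rowP => i; rewrite mxE; move: i; apply: t_inj; apply: crd_inj => l.
  by rewrite -rowM vM0 mxE /crd linear0.
exists (invmx M); split=> // j; apply: crd_inj => l.
rewrite crd_sumZ crd_bas eq_sym; have := mulVmx M_unit.
move/matrixP/(_ j l); rewrite !mxE => <-.
by apply: eq_bigr => i _; rewrite mxE.
Qed.

End Hopf.

(** * Polynomial identities *)

Lemma eq_malg_ext (K : fieldType) (A : choiceType) (V : lmodType K) (F G : seq A -> V)
    (P : free_alg K A) :
  (P@_mone = 0 \/ F [::] = G [::]) -> (forall a w, F (a :: w) = G (a :: w)) ->
  malg_ext F P = malg_ext G P.
Proof.
move=> FG0 FG; apply: eq_bigr => -[[|a w] _]; last by rewrite /= FG.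
case: FG0 => [P0|/= -> //]; have -> : FMonom [::] = mone :> {fmonom A}.
  by apply: val_inj; rewrite /= fm1.
by rewrite P0 !scale0r.
Qed.

(** Serves for evaluation at zero, where only the constant term survives. *)
Lemma malg_ext_const (K : fieldType) (A : choiceType) (V : lmodType K) (F : seq A -> V)
    (P : free_alg K A) :
  (forall a w, F (a :: w) = 0) -> malg_ext F P = P@_mone *: F [::].
Proof.
move=> F0; rewrite /malg_ext.
case: (boolP (mone \in msupp P)) => [P1|P1].
  rewrite (big_fsetD1 mone) //= big_seq big1 ?addr0; first by rewrite fm1.
  move=> [[|a w]]; rewrite !inE /= => /andP[w1 _]; last by rewrite F0 scaler0.
  by rewrite -fmoneE eqxx in w1.
rewrite (mcoeff_outdom P1) scale0r big_seq big1 // => -[[|a w]] wP /=;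
  last by rewrite F0 scaler0.
by rewrite -fmoneE (negbTE P1) in wP.
Qed.

Section PolynomialIdentities.
Variables (K : fieldType) (charK : [pchar K] =i pred0) (W : vectType K).
Variable mul : {bilinear W -> W -> W}.

Local Notation X := (algebra_structure mul).

Let mul_linl y : linear (mul^~ y).
Proof. by move=> c u v; rewrite linearPl. Qed.

Let mul_linr x : linear (mul x).
Proof. by move=> c u v; rewrite linearPr. Qed.

Lemma word_val_nonempty e e' v a (w : seq nat) :
  word_val mul e v (a :: w) = word_val mul e' v (a :: w).
Proof. by elim: w a => [|b w IHw] a //=; move: (IHw b) => /= ->. Qed.

Lemma polynomial_identityP (f : free_alg K nat) : f@_mone = 0 ->
  polynomial_identity mul f <-> forall v, malg_ext (word_val mul 0 v) f = 0.
Proof.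
move=> f0; split=> [[e [_ ef]] v|f0v]; last by exists 0; split; [left|].
rewrite -(ef v); apply: eq_malg_ext; first by left.
by move=> a w; apply: word_val_nonempty.
Qed.

Lemma word_val_word v n (i : 'I_n.+1 -> nat) (j : 'I_n.+1 -> unit) :
  word_val mul 0 v (word (fun a _ => a) i j) = wprod mul (fun k => v (i k)).
Proof.
elim: n i j => [|n IHn] i j; first by rewrite /= enum_ordSl enum_ord0.
have := IHn (fun k => i (lift ord0 k)) (fun=> tt); rewrite /= => <-.
by rewrite enum_ordSl /= enum_ordSl /= -!map_comp.
Qed.

(** The sum needs one common [e], while each summand brings its own. If some constant term is
    nonzero, its [e] is a unit; every other summand has zero constant term or a unit equal to
    [e]. *)
Lemma polynomial_identity_sum n (c : 'I_n -> K) (Q : 'I_n -> free_alg K nat) :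
  (forall i, polynomial_identity mul (Q i)) ->
  polynomial_identity mul (\sum_i c i *: Q i).
Proof.
move=> QP.
have [e [eU eQ]] : exists e : W,
    ((\sum_i c i *: Q i)@_mone = 0 \/ left_id e mul /\ right_id e mul) /\
    forall i v, malg_ext (word_val mul e v) (Q i) = 0.
  case: (boolP [forall i, (Q i)@_mone == 0]) => [/forallP Q0|].
    exists 0; split.
      left; rewrite raddf_sum big1 //= => i _.
      by rewrite mcoeffZ (eqP (Q0 i)) mulr0.
    by move=> i; apply/polynomial_identityP => //; apply/eqP/Q0.
  rewrite negb_forall => /existsP[i Qi]; have [e [eU _]] := QP i.
  have {eU} [el er] : left_id e mul /\ right_id e mul by case: eU Qi => // ->; rewrite eqxx.
  exists e; split; first by right.
  move=> j v; have [e' [e'U e'Q]] := QP j; rewrite -[RHS](e'Q v).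
  apply: eq_malg_ext; last by move=> a w; apply: word_val_nonempty.
  by case: e'U => [->|[e'l _]]; [left|right; rewrite /= -[LHS]e'l er].
exists e; split=> // v; rewrite -[eval _ _ _ _]/(malg_ext _ _).
rewrite (linearity_sum (malg_ext_linear _)) big1 // => i _.
by rewrite (linearityZ (malg_ext_linear _)) eQ scaler0.
Qed.

Theorem polynomial_identities_defined :
  defined_over (field_of_invariants X) (polynomial_identity mul).
Proof.
move=> P; split; last first.
  move=> [n [c [Q [QP ->]]]]; apply: polynomial_identity_sum => i.
  by case: (QP i).
move=> PP; suff : spanned (scalar_mor X) (polynomial_identity mul) P.
  by apply: spannedW => // c; apply: scalar_mor_invariant.
case: (eqVneq P@_mone 0) => [P0|P1].
  apply: (spannedW (K0 := scalar_mor X) (I := identity (fun v => word_val mul 0 v))) => //.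
    by move=> Q [Q0 Qv]; apply/polynomial_identityP.
  apply: (@identities_spanned _ charK _ _ mul_linl mul_linr unit (fun=> id) _ _
    (fun a _ => a) id (fun=> tt)) => //.
  - by move=> _ [].
  - exact: word_val_word.
  - exact: (@inv_base _ _ X tt).
  - by move=> _; apply: inv_id.
  - by split=> //; apply/polynomial_identityP.
have [e [[P0|[el er]] eP]] := PP; first by rewrite P0 eqxx in P1.
(* With a nonzero constant term, evaluation at zero kills the unit [e], so [W] is zero and every
   polynomial is an identity. *)
have e0 : e = 0.
  have := eP (fun=> 0); rewrite -[eval _ _ _ _]/(malg_ext _ _) malg_ext_const /=.
    by move/eqP; rewrite scaler_eq0 (negbTE P1) => /eqP.
  by move=> a [|b w] //=; apply: (linearity0 (mul_linl _)).
have W0 (x : W) : x = 0 by rewrite -[x]el e0; apply: (linearity0 (mul_linl _)).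
by apply: spanned_words => Q; exists e; split; [right|move=> v; apply: W0].
Qed.

End PolynomialIdentities.

(** * H-identities *)

Lemma malg_ext_monoid (K : fieldType) (A : choiceType) (V : algType K) (F : seq A -> V) :
  F [::] = 1 -> (forall s t, F (s ++ t) = F s * F t) ->
  monoid_morphism (malg_ext F).
Proof.
move=> F1 FM; split=> [|P Q].
  by rewrite -[1]/(<< mone >> : free_alg K A) malg_extU fm1.
rewrite malgME (linearity_sum (malg_ext_linear _)) [in RHS]/malg_ext mulr_suml.
apply: eq_bigr => s _; rewrite (linearity_sum (malg_ext_linear _)) mulr_sumr.
apply: eq_bigr => w _; rewrite -scalerAl -scalerAr scalerA -FM.
by rewrite malgU_scale (linearityZ (malg_ext_linear _)) malg_extU fmM.
Qed.

Section HIdentities.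
Variables (k : fieldType) (H : falgType k) (hH : hopf H).
Variables (K : fieldType) (iota : {rmorphism k -> K}).
Hypothesis charK : [pchar K] =i pred0.
Variables (W : falgType K) (c : comodule_algebra hH iota W).

Local Notation X := (comodule_algebra_structure c).
Local Notation Delta := (Delta hH).
Local Notation I := 'I_(\dim {:H}).
Local Notation letter := (nat * I)%type.
Local Notation tensor_alg := (tensor_alg H K).

(** By the counit law the operator of the functional [a *: eps] is [iota a] times the identity, so
    [iota a] is a ratio of two invariant tensors; the identity is nonzero as [1 <> 0] in [W]. *)
Lemma field_of_invariants_iota a : field_of_invariants X (iota a).
Proof.
apply: scalar_mor_invariant.
have id_neq0 : op_tens id != 0 :> tens W 1 1.
  apply/eqP => /ffunP id0; have /eqP := oner_neq0 W; apply.
  rewrite [1]sum_crd big1 // => i _; have := id0 ([tuple i], [tuple i]).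
  rewrite !ffunE /= !(tnth_nth i) /= crd_bas eqxx => /eqP.
  by rewrite oner_eq0.
apply: (ratio_scalar_mor (inv_id X) id_neq0).
have -> : iota a *: op_tens id = op_tens (fun w => applyH iota (a *: eps hH) (rho c w)).
  apply/ffunP => IJ; rewrite !ffunE /= /applyH.
  under eq_bigr => i _ do rewrite lfunE /= rmorphM -scalerA.
  rewrite -scaler_sumr -[X in crd _ (_ *: X)]/(applyH _ _ _) rho_counit.
  by rewrite /crd linearZ.
exact: (@inv_base _ _ X (Some (a *: eps hH))).
Qed.

Lemma pureHE (V : lmodType K) (v : V) (h : H) i : pureH iota v h i = iota (crd i h) *: v.
Proof. exact: ffunE. Qed.

Lemma mulH1 (s : tensH H W) : mulH iota s (pureH iota 1 1) = s.
Proof.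
apply/ffunP => l; rewrite /mulH sum_ffunE.
transitivity (\sum_i iota (crd l (bas i)) *: s i).
  apply: eq_bigr => i _; rewrite sum_ffunE.
  have -> : crd l (bas i) = \sum_j crd j (1 : H) * crd l (bas i * bas j).
    rewrite -crd_sumZ; congr crd; rewrite -[LHS]mulr1 {1}[1 in LHS](sum_crd (1 : H)) mulr_sumr.
    by apply: eq_bigr => j _; rewrite -scalerAr.
  rewrite rmorph_sum scaler_suml; apply: eq_bigr => j _.
  by rewrite !pureHE -scalerAr mulr1 scalerA -rmorphM mulrC.
rewrite (bigD1 l) //= crd_bas eqxx rmorph1 scale1r big1 ?addr0 // => i il.
by rewrite crd_bas eq_sym (negPf il) rmorph0 scale0r.
Qed.

(** * Algebra maps compatible with the coactions *)

Section Comodule.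
Variable phi : {lrmorphism tensor_alg -> W}.

Lemma map_pureH v (h : H) : mapH phi (pureH iota v h) = pureH iota (phi v) h.
Proof. by apply/ffunP => i; rewrite !ffunE linearZ. Qed.

Lemma map_mulH (s t : tensH H tensor_alg) :
  mapH phi (mulH iota s t) = mulH iota (mapH phi s) (mapH phi t).
Proof.
apply/ffunP => l; rewrite ffunE /mulH !sum_ffunE linear_sum; apply: eq_bigr => i _.
rewrite !sum_ffunE linear_sum; apply: eq_bigr => j _.
by rewrite !ffunE linearZ rmorphM.
Qed.

Lemma phi_word (w : seq letter) :
  phi << FMonom w >> = \prod_(a <- w) phi << fmu a >>.
Proof.
elim: w => [|a w IHw].
  by rewrite big_nil -(rmorph1 phi); congr (phi << _ >>); apply: val_inj; rewrite /= fm1.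
rewrite big_cons -IHw -rmorphM; congr (phi _).
rewrite malgM_def fgmulUU mulr1; congr << _ *g _ >>.
by apply: val_inj; rewrite /= fmM fmU.
Qed.

Lemma phiE (P : tensor_alg) :
  phi P = malg_ext (fun w => \prod_(a <- w) phi << fmu a >>) P.
Proof.
rewrite {1}[P]monalgE linear_sum; apply: eq_bigr => w _.
by rewrite malgU_scale linearZ -phi_word fmK.
Qed.

(** Both sides are linear and multiplicative in [Q], so letters suffice. *)
Lemma comodule_letters :
  (forall Q, rho c (phi Q) = mapH phi (rhoT hH iota Q)) <->
  (forall a, rho c (phi << fmu a >>) = mapH phi (rho_letter hH iota a)).
Proof.
have rhoTE Q : rhoT hH iota Q = malg_ext (fun w : seq letter =>
    foldr (fun a t => mulH iota (rho_letter hH iota a) t) (pureH iota 1 1) w) Q by [].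
split=> [rphi a|rphi].
  by rewrite rphi rhoTE malg_extU fmU /= map_mulH map_pureH rmorph1 mulH1.
have rho_word (s : seq letter) : rho c (\prod_(a <- s) phi << fmu a >>) =
    mapH phi (foldr (fun a t => mulH iota (rho_letter hH iota a) t) (pureH iota 1 1) s).
  elim: s => [|a s IHs]; first by rewrite big_nil rho1 /= map_pureH rmorph1.
  by rewrite big_cons rhoM IHs rphi /= map_mulH.
have mapL : linear (mapH phi : tensH H tensor_alg -> tensH H W).
  by move=> a u v; apply/ffunP => i; rewrite !ffunE linearP.
move=> Q; rewrite rhoTE phiE /malg_ext linear_sum (linearity_sum mapL).
apply: eq_bigr => w _; rewrite linearZ (linearityZ mapL); congr (_ *: _).
exact: rho_word.
Qed.

End Comodule.

(** * Comodule maps expressed through the generator [t] *)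

Section Generator.
Variables (t : H) (F : 'M[k]_(\dim {:H})).
Hypotheses (tF : forall j, \sum_i F j i *: Delta t i = bas j)
  (t_inj : forall v : I -> k, \sum_i v i *: Delta t i = 0 -> forall i, v i = 0).

(** The functional [f] with [t_1 f(t_2) = bas j]. *)
Definition dual_gen (j : I) : 'Hom(H, k^o) :=
  linfun (fun h : H => \sum_i crd i h *: (F j i : k^o)).

Lemma dual_genE j i : dual_gen j (bas i) = F j i.
Proof.
rewrite linfun_app => [|a u v].
  rewrite (bigD1 i) //= crd_bas eqxx scale1r big1 ?addr0 // => l /negPf li.
  by rewrite crd_bas li scale0r.
rewrite scaler_sumr -big_split; apply: eq_bigr => l _ /=.
by rewrite crd_linear scalerDl scalerA.
Qed.

Definition tau (j : I) (w : W) : W := applyH iota (dual_gen j) (rho c w).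

Lemma tauE j w : tau j w = \sum_i iota (F j i) *: rho c w i.
Proof. by apply: eq_bigr => i _; rewrite dual_genE. Qed.

Lemma tau_lin j : linear (tau j).
Proof.
move=> a u v; rewrite !tauE scaler_sumr -big_split; apply: eq_bigr => i _ /=.
by rewrite linearP !ffunE scalerDr !scalerA mulrC.
Qed.

Lemma rho_coassocE w i j :
  rho c (rho c w j) i = \sum_l iota (crd i (Delta (bas l) j)) *: rho c w l.
Proof.
have /ffunP/(_ j)/ffunP/(_ i) := rho_coassoc c w.
by rewrite !ffunE sum_ffunE => ->; apply: eq_bigr => l _; apply: ffunE.
Qed.

(** Both sides are the coefficients of [Delta (bas j) l] in the independent family [Delta t m]. *)
Lemma dual_gen_coassoc j l m :
  \sum_i F j i * crd l (Delta (bas m) i) = \sum_i crd i (Delta (bas j) l) * F i m.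
Proof.
apply/eqP; rewrite -subr_eq0; apply/eqP; move: m.
apply: t_inj; under eq_bigr do rewrite scalerBl !scaler_suml.
rewrite sumrB exchange_big [X in _ - X]exchange_big /=.
apply/eqP; rewrite subr_eq0; apply/eqP.
transitivity (Delta (bas j) l).
  rewrite -[in RHS](tF j) linear_sum sum_ffunE; apply: eq_bigr => i _.
  rewrite linearZ ffunE Delta_coassocE scaler_sumr.
  by apply: eq_bigr => m _; rewrite scalerA.
rewrite {1}[Delta (bas j) l]sum_crd; apply: eq_bigr => i _.
rewrite -(tF i) scaler_sumr; apply: eq_bigr => m _.
by rewrite scalerA.
Qed.

(** Expresses that [bas j |-> tau j w] is a comodule map for each [w]; coassociativity of [rho]
    reduces it to [dual_gen_coassoc]. *)
Lemma rho_tau j w l : rho c (tau j w) l = \sum_i iota (crd i (Delta (bas j) l)) *: tau i w.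
Proof.
transitivity (\sum_m iota (\sum_i F j i * crd l (Delta (bas m) i)) *: rho c w m).
  rewrite tauE linear_sum sum_ffunE.
  under eq_bigr => i _ do rewrite linearZ ffunE rho_coassocE scaler_sumr.
  rewrite exchange_big; apply: eq_bigr => m _; rewrite rmorph_sum scaler_suml.
  by apply: eq_bigr => i _; rewrite scalerA rmorphM.
under eq_bigr do rewrite dual_gen_coassoc rmorph_sum scaler_suml.
rewrite exchange_big; apply: eq_bigr => i _; rewrite tauE scaler_sumr.
by apply: eq_bigr => m _; rewrite scalerA rmorphM.
Qed.

Definition ev (v : nat -> W) (w : seq letter) : W := \prod_(a <- w) tau a.2 (v a.1).

Definition lin_ext (L : I -> W) (h : H) : W := \sum_n iota (crd n h) *: L n.

(** A comodule map commutes with the operators of functionals, and [bas j] is the image of [t] under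
    that of [dual_gen j]. *)
Lemma comodule_map_tau (L : I -> W) :
    (forall m l, rho c (L m) l = lin_ext L (Delta (bas m) l)) ->
  forall j, L j = tau j (lin_ext L t).
Proof.
move=> rhoL j.
have rho_lin_ext l : rho c (lin_ext L t) l = lin_ext L (Delta t l).
  rewrite {1}/lin_ext linear_sum sum_ffunE.
  transitivity (\sum_m \sum_n iota (crd m t * crd n (Delta (bas m) l)) *: L n).
    apply: eq_bigr => m _; rewrite linearZ ffunE rhoL scaler_sumr.
    by apply: eq_bigr => n _; rewrite scalerA rmorphM.
  rewrite exchange_big; apply: eq_bigr => n _.
  rewrite -scaler_suml -rmorph_sum -crd_sumZ; congr (iota (crd n _) *: _).
  rewrite {2}[t]sum_crd linear_sum sum_ffunE; apply: eq_bigr => m _.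
  by rewrite linearZ ffunE.
transitivity (lin_ext L (\sum_l F j l *: Delta t l)).
  rewrite tF /lin_ext (bigD1 j) //= crd_bas eqxx rmorph1 scale1r big1 ?addr0 // => l /negPf lj.
  by rewrite crd_bas lj rmorph0 scale0r.
rewrite tauE; under [RHS]eq_bigr do rewrite rho_lin_ext scaler_sumr.
rewrite exchange_big; apply: eq_bigr => n _.
rewrite crd_sumZ rmorph_sum scaler_suml; apply: eq_bigr => l _.
by rewrite scalerA rmorphM.
Qed.

Lemma comodule_ev (phi : {lrmorphism tensor_alg -> W}) :
  (forall Q, rho c (phi Q) = mapH phi (rhoT hH iota Q)) ->
  exists v, phi =1 malg_ext (ev v).
Proof.
move/comodule_letters => rphi.
exists (fun i => lin_ext (fun n => phi << fmu (i, n) >>) t) => P.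
rewrite phiE; apply: eq_bigr => w _; congr (_ *: _).
apply: eq_bigr => -[i j] _; apply: (comodule_map_tau (L := fun n => phi << fmu (i, n) >>)).
move=> m l; rewrite rphi !ffunE /gen linear_sum.
by apply: eq_bigr => n _; apply: linearZ.
Qed.

(** On letters, compatibility with the coactions is [rho_tau], so every choice of [v] occurs. *)
Lemma ev_comodule v : exists2 phi : {lrmorphism tensor_alg -> W},
  phi =1 malg_ext (ev v) &
  forall Q, rho c (phi Q) = mapH phi (rhoT hH iota Q).
Proof.
have ev_monoid : monoid_morphism (malg_ext (ev v)).
  by apply: malg_ext_monoid => [|s w]; rewrite /ev ?big_nil ?big_cat.
pose phi : {lrmorphism tensor_alg -> W} := HB.pack (malg_ext (ev v))
  (GRing.isLinear.Build K tensor_alg W *:%R (malg_ext (ev v)) (malg_ext_linear (ev v)))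
  (GRing.isMonoidMorphism.Build tensor_alg W (malg_ext (ev v)) ev_monoid).
have phi_letter i j : phi << fmu (i, j) >> = tau j (v i).
  by rewrite /= malg_extU fmU /ev big_seq1.
exists phi => //; apply/comodule_letters => -[i j].
apply/ffunP => l; rewrite phi_letter rho_tau !ffunE /gen linear_sum.
by apply: eq_bigr => m _; rewrite linearZ; congr (_ *: _); apply/esym/phi_letter.
Qed.

Lemma H_identityP P : H_identity c P <-> forall v, malg_ext (ev v) P = 0.
Proof.
split=> [HP v|evP phi /comodule_ev[v ->]]; last exact: evP.
by have [phi phiE rphi] := ev_comodule v; rewrite -phiE; apply: HP.
Qed.

Lemma ev_word v n (i : 'I_n.+1 -> nat) (j : 'I_n.+1 -> I) :
  ev v (word (fun a b => (a, b)) i j) = wprod *%R (fun l => tau (j l) (v (i l))).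
Proof.
rewrite /ev /= big_map.
elim: n i j => [|n IHn] i j; first by rewrite enum_ordSl enum_ord0 big_seq1.
rewrite enum_ordSl big_cons big_map; congr (_ * _).
exact: (IHn (fun l => i (lift ord0 l)) (fun l => j (lift ord0 l))).
Qed.

Lemma H_identities_spanned P :
  H_identity c P -> spanned (field_of_invariants X) (H_identity c) P.
Proof.
move=> /H_identityP evP.
apply: (spannedW (K0 := scalar_mor X) (I := identity ev)) => [a|Q [_ Qv]|].
- exact: scalar_mor_invariant.
- exact/H_identityP.
apply: (@identities_spanned _ charK _ *%R _ _ _ tau tau_lin _ (fun a b => (a, b)) fst snd) => //.
- by move=> y a u w; rewrite mulrDl -scalerAl.
- by move=> y a u w; rewrite mulrDr -scalerAr.
- by case.
- exact: ev_word.
- exact: (@inv_base _ _ X None).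
- by move=> j; apply: (@inv_base _ _ X (Some (dual_gen j))).
(* Evaluation at zero shows that the constant term vanishes, as [1 <> 0] in [W]. *)
split=> //; have := evP (fun=> 0); rewrite malg_ext_const => [|[i j] w].
  by rewrite /ev big_nil => /eqP; rewrite scaler_eq0 oner_eq0 orbF => /eqP.
by rewrite /ev big_cons (linearity0 (tau_lin _)) mul0r.
Qed.

End Generator.

Theorem H_identities_defined : defined_over (field_of_invariants X) (H_identity c).
Proof.
have [t [F [tF t_inj]]] := free_rank1 hH.
move=> P; split; first exact: (H_identities_spanned tF t_inj).
move=> [n [a [Q [QP ->]]]] phi rphi; rewrite linear_sum big1 // => i _.
transitivity (a i *: phi (Q i)); first exact: linearZ.
by have [/(_ phi rphi) -> _] := QP i; rewrite scaler0.
Qed.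

End HIdentities.

Theorem theorem1p5 (K : closedFieldType) (charK : [pchar K] =i pred0) :
  (forall (W : vectType K) (mul : {bilinear W -> W -> W}),
     associative mul ->
     defined_over (field_of_invariants (algebra_structure mul))
       (polynomial_identity mul)) /\
  (forall (k : fieldType) (iota : {rmorphism k -> K}) (H : falgType k)
     (hH : hopf H) (W : falgType K) (c : comodule_algebra hH iota W),
     (forall a : k,
        field_of_invariants (comodule_algebra_structure c) (iota a)) /\
     defined_over (field_of_invariants (comodule_algebra_structure c))
       (H_identity c)).
Proof.
split=> [W mul _|k iota H hH W c]; first exact: polynomial_identities_defined.
by split; [apply: field_of_invariants_iota|apply: H_identities_defined].
Qed.
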